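(* The space $\mathbb F=F(\beta,\gamma)\otimes F(\bar\beta,\bar\gamma)\otimes\mathbb C[\mathbf P]$ gives a realization of the algebra $\mathfrak R(G_0)$, i.e. the linear map $\mathbb F\to\mathfrak R(G_0)$, $\beta^m\bar\beta^n\mathbf 1_\lambda\mapsto x^m(-y)^n\zeta^\lambda$, is an isomorphism of algebras which intertwines the $\mathfrak g\oplus\mathfrak g$-action on $\mathbb F$ given in (1) below with the regular actions $(\pi_l,\pi_r)$ on $\mathfrak R(G_0)$. In particular: (1) The space $\mathbb F$ has a $\mathfrak g\oplus\mathfrak g$-module structure, in which the first (left) copy of $\mathfrak g$ acts by $$\mathbf e=\gamma,\qquad \mathbf h=2\beta\gamma+a,\qquad \mathbf f=-\beta^2\gamma-\beta a+\bar\gamma\,\mathbf 1_{-2},$$ and the second (right) copy acts by $$\bar{\mathbf e}=\bar\gamma,\qquad \bar{\mathbf h}=2\bar\beta\bar\gamma+a,\qquad \bar{\mathbf f}=-\bar\beta^2\bar\gamma-\bar\beta a+\gamma\,\mathbf 1_{-2}.$$ (2) The space $\mathbb F$ has a compatible commutative algebra structure (i.e. the multiplication $\mathbb F\otimes\mathbb F\to\mathbb F$ intertwines the $\mathfrak g\oplus\mathfrak g$-action).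
   Context: Let $G=SL(2,\mathbb C)$ and $\mathfrak g=\mathfrak{sl}(2,\mathbb C)$ with standard basis $\mathbf e,\mathbf h,\mathbf f$, $[\mathbf h,\mathbf e]=2\mathbf e$, $[\mathbf h,\mathbf f]=-2\mathbf f$, $[\mathbf e,\mathbf f]=\mathbf h$. The weight lattice is $\mathbf P\cong\mathbb Z$. The big Bruhat cell $G_0\subset G$ is the set of $g=\begin{pmatrix}1&x\\0&1\end{pmatrix}\begin{pmatrix}0&-1\\1&0\end{pmatrix}\begin{pmatrix}\zeta&0\\0&\zeta^{-1}\end{pmatrix}\begin{pmatrix}1&y\\0&1\end{pmatrix}$ with $x,y\in\mathbb C$, $\zeta\in\mathbb C^\times$; its algebra of regular functions is $\mathfrak R(G_0)=\mathbb C[x,y,\zeta^{\pm1}]$. The left and right regular (infinitesimal) actions of $\mathfrak g$ on $\mathfrak R(G_0)$ are $(\pi_l(u)\psi)(g)=\frac{d}{dt}\psi(e^{-tu}g)|_{t=0}$ and $(\pi_r(u)\psi)(g)=\frac{d}{dt}\psi(g\,e^{tu})|_{t=0}$, $u\in\mathfrak g$. $F(\beta,\gamma)$ denotes the irreducible module over the Heisenberg algebra $[\beta,\gamma]=1$ generated by a vector $\mathbf 1$ with $\gamma\mathbf 1=0$; thus $F(\beta,\gamma)=\mathbb C[\beta]$ with $\gamma=-\partial_\beta$. $F(\bar\beta,\bar\gamma)$ is a second copy, with generators $\bar\beta,\bar\gamma$ (the bar does not denote complex conjugation). $\mathbb C[\mathbf P]$ is the group algebra of $\mathbf P$ with basis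 $\mathbf 1_\lambda$ and product $\mathbf 1_\lambda\mathbf 1_\mu=\mathbf 1_{\lambda+\mu}$; $a$ acts on it by $a\mathbf 1_\lambda=\lambda\mathbf 1_\lambda$. On $\mathbb F$, $\mathbf 1_{-2}$ denotes the operator of multiplication by $\mathbf 1_{-2}$ in the factor $\mathbb C[\mathbf P]$. As a commutative algebra, $\mathbb F=\mathbb C[\beta]\otimes\mathbb C[\bar\beta]\otimes\mathbb C[\mathbf P]$. *)

(* Defs.v *)
From HB Require Import structures.
From mathcomp Require Import all_boot all_order all_algebra finmap.
From mathcomp.multinomials Require Import monalg.
From mathcomp Require Import all_classical all_reals all_analysis.
From mathcomp Require Import complex ring.

Set Implicit Arguments.
Unset Strict Implicit.
Unset Printing Implicit Defensive.

Import Order.TTheory GRing.Theory Num.Theory.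
Import numFieldNormedType.Exports.

Local Open Scope classical_set_scope.
Local Open Scope ring_scope.

(* The complex numbers R[i], typed so that the normed-module (hence
   topological) structure of a numClosedFieldType over itself applies. *)
Definition cplx (R : realType) : numClosedFieldType := R[i].

(* Finitely supported functions int -> K with the convolution product. An
   alias of {malg K[int]} is needed because monalg only makes {malg K[M]} a
   ring when M has no invertible element besides its unit. *)
Definition grpalg (K : comNzRingType) : Type := {malg K[int]}.

HB.instance Definition _ (K : comNzRingType) :=
  GRing.Lmodule.copy (grpalg K) {malg K[int]}.

HB.lock Definition ga_mul (K : comNzRingType) (x y : grpalg K) : grpalg K :=
  \sum_(k <- msupp x) \sum_(l <- msupp y) << x@_k * y@_l *g k + l >>.
Arguments ga_mul {K} x y.

Section GroupAlgebra.
Variable K : comNzRingType.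

Local Notation A := (grpalg K).
Implicit Types (x y z : A) (k l : int).

Definition ga_one : A := << 0 >>.

Fact ga_mulw (d1 d2 : {fset int}) x y :
  (msupp x `<=` d1)%fset -> (msupp y `<=` d2)%fset ->
  ga_mul x y = \sum_(k <- d1) \sum_(l <- d2) << x@_k * y@_l *g k + l >>.
Proof.
move=> le1 le2; rewrite ga_mul.unlock (big_fset_incl _ le1) /=.
  apply: eq_bigr => k _; apply: big_fset_incl => // l _ /mcoeff_outdom ->.
  by rewrite mulr0 monalgU0.
move=> k _ /mcoeff_outdom xk.
by rewrite big1 // => l _; rewrite xk mul0r monalgU0.
Qed.

Fact ga_mulC : commutative (@ga_mul K).
Proof.
move=> x y; rewrite !ga_mul.unlock exchange_big; apply: eq_bigr => k _.
by apply: eq_bigr => l _; rewrite mulrC addrC.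
Qed.

Fact ga_mulDl : left_distributive (@ga_mul K) +%R.
Proof.
move=> x y z; pose d := (msupp x `|` msupp y)%fset.
rewrite !(@ga_mulw d (msupp z)) ?fsubsetUl ?fsubsetUr ?fsubset_refl //;
  last exact: msuppD_le.
rewrite -big_split /=; apply: eq_bigr => k _.
rewrite -big_split /=; apply: eq_bigr => l _.
by rewrite mcoeffD mulrDl monalgUD.
Qed.

Fact ga_mul0 : left_zero 0 (@ga_mul K).
Proof. by move=> x; rewrite ga_mul.unlock msupp0 big_seq_fset0. Qed.

Fact ga_mulUU (a b : K) k l :
  ga_mul << a *g k >> << b *g l >> = << a * b *g k + l >>.
Proof. by rewrite (ga_mulw msuppU_le msuppU_le) !big_seq_fset1 !mcoeffUU. Qed.

Fact ga_mulDr : right_distributive (@ga_mul K) +%R.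
Proof. by move=> x y z; rewrite ga_mulC ga_mulDl !(ga_mulC _ x). Qed.

Fact ga_mul0r : right_zero 0 (@ga_mul K).
Proof. by move=> x; rewrite ga_mulC ga_mul0. Qed.

Fact ga_mulr_sum (I : Type) (r : seq I) (F : I -> A) x :
  ga_mul x (\sum_(i <- r) F i) = \sum_(i <- r) ga_mul x (F i).
Proof. exact: (big_morph (ga_mul x) (ga_mulDr x) (ga_mul0r x)). Qed.

Fact ga_mull_sum (I : Type) (r : seq I) (F : I -> A) x :
  ga_mul (\sum_(i <- r) F i) x = \sum_(i <- r) ga_mul (F i) x.
Proof. by rewrite ga_mulC ga_mulr_sum; apply: eq_bigr => i _; rewrite ga_mulC. Qed.

Fact ga_sumE x : x = \sum_(k <- msupp x) (<< x@_k *g k >> : A).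
Proof. exact: monalgE. Qed.

Fact ga_mulA : associative (@ga_mul K).
Proof.
move=> x y z; rewrite [x]ga_sumE [y]ga_sumE [z]ga_sumE.
rewrite !ga_mull_sum; apply: eq_bigr => k _.
rewrite !(ga_mulr_sum _ _ << x@_k *g k >>) ga_mull_sum.
apply: eq_bigr => l _.
rewrite !ga_mulr_sum; apply: eq_bigr => m _.
by rewrite !ga_mulUU mulrA addrA.
Qed.

Fact ga_mul1 : left_id ga_one (@ga_mul K).
Proof.
move=> x; rewrite [x]ga_sumE ga_mulr_sum; apply: eq_bigr => k _.
by rewrite ga_mulUU mul1r add0r.
Qed.

Fact ga_scaleE (a : K) x : a *: x = ga_mul << a *g 0 >> x.
Proof.
rewrite [x]ga_sumE ga_mulr_sum scaler_sumr; apply: eq_bigr => k _.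
rewrite ga_mulUU add0r; apply/malgP => l.
by rewrite mcoeffZ !mcoeffU mulrnAr.
Qed.

Fact ga_one_neq0 : ga_one != 0.
Proof. by apply/eqP/malgP => /(_ 0) /eqP; rewrite mcoeffUU mcoeff0 oner_eq0. Qed.

HB.instance Definition _ := GRing.Zmodule_isComNzRing.Build A
  ga_mulA ga_mulC ga_mul1 ga_mulDl ga_one_neq0.

Fact ga_scalerAl (a : K) x y : a *: (x * y) = a *: x * y.
Proof. by rewrite !ga_scaleE [LHS]ga_mulA. Qed.

HB.instance Definition _ := GRing.Lmodule_isLalgebra.Build K A ga_scalerAl.

Fact ga_algM (a b : K) : a%:A * b%:A = (a * b)%:A :> A.
Proof. by rewrite mulr_algl scalerA. Qed.

HB.instance Definition _ := GRing.Lalgebra_isComAlgebra.Build K A.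

End GroupAlgebra.

Fact map_deriv_subproof (A : comNzRingType) (q : {poly {poly A}}) :
  'X%:P * - map_poly (@deriv A) q - - map_poly (@deriv A) ('X%:P * q) = q.
Proof.
rewrite mulrN opprK addrC; apply/polyP => i.
rewrite coefB coefCM !coef_map_id0 ?deriv0 // coefCM derivM derivX mul1r.
by rewrite addrK.
Qed.

(* C[beta] (x) C[betab] (x) C[P], encoded as C[P][betab][beta]; the outer
   indeterminate is beta, the inner one betab. *)
Definition fock (K : comNzRingType) : Type := {poly {poly grpalg K}}.

HB.lock Definition fock_const (K : comNzRingType) (x : grpalg K) : fock K :=
  x%:P%:P.
Arguments fock_const {K} x.

Section Fock.
Variable K : comNzRingType.

HB.instance Definition _ := GRing.ComNzRing.copy (fock K) {poly {poly grpalg K}}.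

Local Notation F := (fock K).
Implicit Types (c : K) (p q : F).

Definition fock_scale c p : F := fock_const (c *: 1) * p.

Fact fock_const1 : fock_const (1 : grpalg K) = 1.
Proof. by rewrite fock_const.unlock !polyC1. Qed.

Fact fock_constM x y : fock_const (x * y) = fock_const x * fock_const y.
Proof. by rewrite !fock_const.unlock !polyCM. Qed.

Fact fock_constD x y : fock_const (x + y) = fock_const x + fock_const y.
Proof. by rewrite !fock_const.unlock !polyCD. Qed.

Fact fock_scaleA c d p : fock_scale c (fock_scale d p) = fock_scale (c * d) p.
Proof.
by rewrite /fock_scale mulrA -fock_constM ga_algM.
Qed.

Fact fock_scale1 : left_id 1 fock_scale.
Proof. by move=> p; rewrite /fock_scale scale1r fock_const1 mul1r. Qed.

Fact fock_scaleDr : right_distributive fock_scale +%R.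
Proof. by move=> c p q; rewrite /fock_scale mulrDr. Qed.

Fact fock_scaleDl p : {morph fock_scale^~ p : c d / c + d}.
Proof. by move=> c d; rewrite /fock_scale scalerDl fock_constD mulrDl. Qed.

HB.instance Definition _ := GRing.Zmodule_isLmodule.Build K F
  fock_scaleA fock_scale1 fock_scaleDr fock_scaleDl.

Fact fock_scalerAl c p q : c *: (p * q) = c *: p * q.
Proof. by rewrite /GRing.scale /= /fock_scale mulrA. Qed.

HB.instance Definition _ := GRing.Lmodule_isLalgebra.Build K F fock_scalerAl.
HB.instance Definition _ := GRing.Lalgebra_isComAlgebra.Build K F.

Definition beta : F := 'X.
Definition betab : F := 'X%:P.
Definition one_ (l : int) : F := fock_const << l >>.

(* gamma = - d/d beta: the Fock module is C[beta] with [beta, gamma] = 1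
   and gamma 1 = 0. *)
Definition gam p : F := - deriv p.
Definition gamb p : F := - map_poly (@deriv (grpalg K)) p.

(* a 1_l = l 1_l on C[P], extended coefficientwise. *)
Definition ga_deg (x : grpalg K) : grpalg K :=
  \sum_(l <- msupp x) << x@_l * l%:~R *g l >>.
Definition aop p : F := map_poly (map_poly ga_deg) p.

Lemma heisenberg p : beta * gam p - gam (beta * p) = p.
Proof.
rewrite /gam /beta [deriv ('X * p)](derivM (R := {poly grpalg K})) derivX mul1r.
by rewrite mulrN opprK addrC addrK.
Qed.

Lemma heisenbergb p : betab * gamb p - gamb (betab * p) = p.
Proof. exact: map_deriv_subproof. Qed.

Lemma ga_degU (c : K) l : ga_deg << c *g l >> = << c * l%:~R *g l >>.
Proof.
rewrite /ga_deg msuppU; case: (eqVneq c 0) => [->|_].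
  by rewrite mul0r monalgU0 big_seq_fset0.
by rewrite big_seq_fset1 mcoeffUU.
Qed.

End Fock.

Arguments beta {K}.
Arguments betab {K}.
Arguments one_ {K} l.

Section LieAlgebra.
Variable K : comNzRingType.

Definition mx22 (a b c d : K) : 'M[K]_2 :=
  \matrix_(i, j) if i == 0 then (if j == 0 then a else b)
                 else (if j == 0 then c else d).

Fact mxtrace_mx22 a b c d : \tr (mx22 a b c d) = a + d.
Proof. by rewrite /mxtrace !big_ord_recl big_ord0 !mxE /= addr0. Qed.

Fact det_mx22 a b c d : \det (mx22 a b c d) = a * d - b * c.
Proof.
rewrite (expand_det_row _ 0) !big_ord_recl big_ord0 !mxE /= /cofactor.
by rewrite !det_mx11 !mxE /= expr0 expr1; ring.
Qed.

Fact mx22M a b c d a' b' c' d' :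
  mx22 a b c d *m mx22 a' b' c' d'
  = mx22 (a * a' + b * c') (a * b' + b * d')
         (c * a' + d * c') (c * b' + d * d').
Proof.
apply/matrixP => i j; rewrite !mxE !big_ord_recl big_ord0 !mxE /= addr0.
by case: (i == 0); case: (j == 0).
Qed.

Fact mx22B a b c d a' b' c' d' :
  mx22 a b c d - mx22 a' b' c' d' = mx22 (a - a') (b - b') (c - c') (d - d').
Proof.
by apply/matrixP => i j; rewrite !mxE; case: (i == 0); case: (j == 0).
Qed.

Fact mx22Z k a b c d : k *: mx22 a b c d = mx22 (k * a) (k * b) (k * c) (k * d).
Proof.
by apply/matrixP => i j; rewrite !mxE; case: (i == 0); case: (j == 0).
Qed.

Definition sl2_pred : {pred 'M[K]_2} := [pred u | \tr u == 0].

Record sl2 := Sl2 { sl2_val :> 'M[K]_2; _ : sl2_val \in sl2_pred }.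

HB.instance Definition _ := [isSub for sl2_val].
HB.instance Definition _ := [Choice of sl2 by <:].

Fact sl2_submod_closed : subsemimod_closed sl2_pred.
Proof.
split; first split.
- by rewrite inE mxtrace0.
- by move=> u v; rewrite !inE => /eqP tu /eqP tv; rewrite mxtraceD tu tv addr0.
- by move=> a u; rewrite !inE => /eqP tu; rewrite mxtraceZ tu mulr0.
Qed.

HB.instance Definition _ :=
  GRing.SubChoice_isSubLmodule.Build K 'M[K]_2 sl2_pred sl2
    sl2_submod_closed.

Fact sl2_bracket_subproof (u v : sl2) :
  sl2_val u *m sl2_val v - sl2_val v *m sl2_val u \in sl2_pred.
Proof. by rewrite inE raddfB /= mxtrace_mulC subrr. Qed.

Definition sl2_bracket (u v : sl2) : sl2 := Sl2 (sl2_bracket_subproof u v).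

Fact sl2_e_subproof : mx22 0 1 0 0 \in sl2_pred.
Proof. by rewrite inE mxtrace_mx22 addr0. Qed.
Fact sl2_h_subproof : mx22 1 0 0 (- 1) \in sl2_pred.
Proof. by rewrite inE mxtrace_mx22 subrr. Qed.
Fact sl2_f_subproof : mx22 0 0 1 0 \in sl2_pred.
Proof. by rewrite inE mxtrace_mx22 addr0. Qed.

Definition sl2_e : sl2 := Sl2 sl2_e_subproof.
Definition sl2_h : sl2 := Sl2 sl2_h_subproof.
Definition sl2_f : sl2 := Sl2 sl2_f_subproof.

Lemma sl2_bracket_he : sl2_bracket sl2_h sl2_e = 2 *: sl2_e.
Proof. by apply: val_inj; rewrite /= !mx22M mx22Z mx22B; congr mx22; ring. Qed.
Lemma sl2_bracket_hf : sl2_bracket sl2_h sl2_f = - 2 *: sl2_f.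
Proof. by apply: val_inj; rewrite /= !mx22M mx22Z mx22B; congr mx22; ring. Qed.
Lemma sl2_bracket_ef : sl2_bracket sl2_e sl2_f = sl2_h.
Proof. by apply: val_inj; rewrite /= !mx22M mx22B; congr mx22; ring. Qed.

Definition sl2x2_bracket (w w' : sl2 * sl2) : sl2 * sl2 :=
  (sl2_bracket w.1 w'.1, sl2_bracket w.2 w'.2).

Definition lie_module (L V : lmodType K) (br : L -> L -> L)
    (rho : L -> V -> V) : Prop :=
  [/\ forall w, linear (rho w),
      forall v, linear (rho^~ v)
    & forall w w' v, rho (br w w') v = rho w (rho w' v) - rho w' (rho w v)].

(* The multiplication B (x) B -> B intertwines rho, where w acts on
   B (x) B by rho w (x) id + id (x) rho w. *)
Definition lie_compatible (L : lmodType K) (B : comAlgType K)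
    (rho : L -> B -> B) : Prop :=
  forall w p q, rho w (p * q) = rho w p * q + p * rho w q.

End LieAlgebra.

Arguments sl2_e {K}.
Arguments sl2_h {K}.
Arguments sl2_f {K}.

Section BigCell.
Variable K : numClosedFieldType.

Definition bruhat_mx (x y z : K) : 'M[K]_2 :=
  mx22 1 x 0 1 *m mx22 0 (- 1) 1 0 *m mx22 z 0 0 z^-1 *m mx22 1 y 0 1.

Fact bruhat_mxE (x y z : K) : z != 0 ->
  bruhat_mx x y z = mx22 (x * z) (x * z * y - z^-1) z (z * y).
Proof. by move=> hz; rewrite /bruhat_mx !mx22M; congr mx22; ring. Qed.

Fact det_bruhat_mx (x y z : K) : z != 0 -> \det (bruhat_mx x y z) = 1.
Proof. by move=> hz; rewrite bruhat_mxE // det_mx22; field. Qed.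

Definition bigcell_pred : {pred 'M[K]_2} :=
  fun g => `[< exists x y z : K, z != 0 /\ g = bruhat_mx x y z >].

Record bigcell :=
  BigCell { bigcell_val :> 'M[K]_2; _ : bigcell_val \in bigcell_pred }.

HB.instance Definition _ := [isSub for bigcell_val].
HB.instance Definition _ := [Choice of bigcell by <:].

Fact bruhat_subproof (x y z : K) (hz : z != 0) :
  bruhat_mx x y z \in bigcell_pred.
Proof. by apply/asboolP; exists x, y, z. Qed.

Definition bruhat (x y z : K) (hz : z != 0) : bigcell :=
  BigCell (bruhat_subproof x y hz).

(* psi is regular on G_0 when it is a Laurent polynomial in x, y, zeta^{+-1};
   s lists the terms t = (c, m, n, l), standing for c x^m y^n zeta^l. *)
Definition is_regular (psi : bigcell -> K) : Prop :=
  exists s : seq (K * nat * nat * int),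
    forall (x y z : K) (hz : z != 0),
      psi (bruhat x y hz)
      = \sum_(t <- s) t.1.1.1 * x ^+ t.1.1.2 * y ^+ t.1.2 * z ^ t.2.

Definition regular_fun : {pred bigcell -> K} := fun psi => `[< is_regular psi >].

Fact regular_funP psi : reflect (is_regular psi) (psi \in regular_fun).
Proof. exact: asboolP. Qed.

Record regular := Regular {
  regular_val :> bigcell -> K;
  _ : regular_val \in regular_fun }.

HB.instance Definition _ := [isSub for regular_val].
HB.instance Definition _ := [Choice of regular by <:].

Fact regular_subring_closed : subring_closed regular_fun.
Proof.
split.
- apply/regular_funP; exists [:: (1, 0%N, 0%N, 0)] => x y z hz.
  by rewrite big_seq1 /= !expr0 expr0z !mulr1.
- move=> f g /regular_funP[s fs] /regular_funP[s' gs].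
  apply/regular_funP; exists (s ++ [seq (- t.1.1.1, t.1.1.2, t.1.2, t.2) | t <- s']).
  move=> x y z hz; rewrite big_cat big_map /= -fs.
  under eq_bigr do rewrite !mulNr.
  by rewrite sumrN -gs.
- move=> f g /regular_funP[s fs] /regular_funP[s' gs].
  apply/regular_funP; exists [seq (t.1.1.1 * u.1.1.1, t.1.1.2 + u.1.1.2,
    t.1.2 + u.1.2, t.2 + u.2)%R | t <- s, u <- s'].
  move=> x y z hz; rewrite big_allpairs_dep /= mulrfctE fs gs mulr_suml.
  apply: eq_bigr => t _; rewrite mulr_sumr; apply: eq_bigr => u _.
  rewrite !exprD expfzDr //; ring.
Qed.

Fact regular_scaler_closed : GRing.scaler_closed regular_fun.
Proof.
move=> a f /regular_funP[s fs]; apply/regular_funP.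
exists [seq (a * t.1.1.1, t.1.1.2, t.1.2, t.2) | t <- s] => x y z hz.
rewrite big_map /= scalrfctE fs scaler_sumr.
by apply: eq_bigr => t _; rewrite [LHS]/GRing.scale /= !mulrA.
Qed.

HB.instance Definition _ :=
  GRing.SubChoice_isSubComPzRing.Build (bigcell -> K) regular_fun regular
    regular_subring_closed.

Fact regular_submod_closed : subsemimod_closed regular_fun.
Proof.
split; last exact: regular_scaler_closed.
have [r1 rB _] := regular_subring_closed.
have r0 : 0 \in regular_fun by rewrite -(subrr 1); exact: rB.
by split=> // f g fr gr; rewrite -[g]opprK -[- g]sub0r; apply/rB/rB.
Qed.

HB.instance Definition _ :=
  GRing.SubZmodule_isSubLmodule.Build K (bigcell -> K) regular_fun regular
    regular_submod_closed.

Fact regular_oner_neq0 : 1 != 0 :> regular.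
Proof.
apply/eqP => /(congr1 (fun f : regular => f (bruhat 0 0 (oner_neq0 K)))).
by apply/eqP; exact: oner_neq0.
Qed.

HB.instance Definition _ :=
  GRing.PzSemiRing_isNonZero.Build regular regular_oner_neq0.

Fact regular_scalerAl (a : K) (f g : regular) : a *: (f * g) = a *: f * g.
Proof. by apply: val_inj; apply/funext => x; exact: mulrA. Qed.

HB.instance Definition _ :=
  GRing.Lmodule_isLalgebra.Build K regular regular_scalerAl.
HB.instance Definition _ := GRing.Lalgebra_isComAlgebra.Build K regular.

(* The matrix exponential, as a limit in the normed space of 2 x 2 matrices. *)
Definition expmx (A : 'M[K]_2) : 'M[K]_2 :=
  lim (series (fun n : nat => (n`!%:R)^-1 *: A ^+ n) @ \oo).

(* psi extended by 0 to all matrices. Since G_0 is open in G, e^{-tu} g and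
   g e^{tu} stay in G_0 for small t, so the derivatives at t = 0 below do not
   depend on the values outside G_0. *)
Definition ext0 (psi : bigcell -> K) (M : 'M[K]_2) : K :=
  oapp psi 0 (insub M).

Definition orbit_l (u : sl2 K) (psi : bigcell -> K) (g : bigcell) (t : K) : K :=
  ext0 psi (expmx (- t *: sl2_val u) *m g).
Definition orbit_r (u : sl2 K) (psi : bigcell -> K) (g : bigcell) (t : K) : K :=
  ext0 psi (bigcell_val g *m expmx (t *: sl2_val u)).

Definition pi_l (u : sl2 K) (psi : bigcell -> K) : bigcell -> K :=
  fun g => 'D_1 (orbit_l u psi g) 0.
Definition pi_r (u : sl2 K) (psi : bigcell -> K) : bigcell -> K :=
  fun g => 'D_1 (orbit_r u psi g) 0.

End BigCell.

(* Main.v *)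
Require Import Defs.
From HB Require Import structures.
From mathcomp Require Import all_boot all_order all_algebra finmap.
From mathcomp.multinomials Require Import monalg.
From mathcomp Require Import all_classical all_reals all_analysis.
From mathcomp Require Import complex ring.

Set Implicit Arguments.
Unset Strict Implicit.
Unset Printing Implicit Defensive.

Import Order.TTheory GRing.Theory Num.Theory.
Import numFieldNormedType.Exports.

Local Open Scope classical_set_scope.
Local Open Scope ring_scope.

(** The Fock space is the algebra C[x, y, zeta^(+-1)] under other names: beta
    is x, betab is - y and 1_l is zeta^l.  Its universal property
    ([fock_universal]) gives the algebra morphism Phi to the regular functions
    with these values.  It is injective because a Laurent polynomial that
    vanishes at all points with zeta != 0 is zero ([fock_eval_inj]), and
    surjective because every regular function is a combination of monomials.

    Under this identification gamma, gammab and a are the derivations - d/dx,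
    d/dy and zeta d/dzeta, and multiplication by 1_(-2) commutes with gamma and
    gammab.  Hence each (u, v) in sl2 x sl2 acts by a vector field
      [vf_gam] * gamma + [vf_gamb] * gammab + [vf_a] * a
    that depends linearly on (u, v).  An operator of this form is a derivation,
    which is the compatibility with the product.  A derivation that kills the
    scalars is determined by its values on beta, betab and 1_1
    ([derivation_eq]), since 1_(-1) is the inverse of 1_1; both sides of the
    bracket identity are such derivations, so the module axiom is an identity
    between polynomials on three generators.

    The same principle gives the intertwining.  Differentiating psi along the
    curve e^(-tu) g, or g e^(tu), satisfies the Leibniz rule, so it is enough
    to compare with the vector fields on the generators
    ([derivation_along_curve]).  There x, y and zeta are rational in the
    matrix entries, x = g00 / g10, y = g11 / g10 and zeta = g10, and one needs
    that the curve has velocity - u g, resp. g u, at 0 and stays in the big cell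
    for small t.  The big cell is det = 1 and g10 != 0; the second condition is
    open, and the first one is det (exp (t u)) = 1 for a traceless u.

    The exponential is handled without general theory.  By Cayley-Hamilton
    u^2 = w 1 with w = - det u, so exp (t u) = P 1 + Q u where P and Q are two
    scalar power series in t ([expmxE]), that is cosh (c t) and sinh (c t) / c
    for c^2 = w (1 and t if w = 0).  Comparison with the first two terms
    gives the derivatives at 0 ([egf_is_derive]).  The determinant is
    P^2 - w Q^2, the limit of products of partial sums of e^(c t) and
    e^(- c t); this limit is 1 ([exp_partialN_cvg]). *)

(** * Derivations and the Fock space as an algebra *)

Definition derivation (A : comNzRingType) (D : A -> A) : Prop :=
  (forall x y, D (x + y) = D x + D y) /\
  (forall x y, D (x * y) = D x * y + x * D y).

Section Derivations.
Variable A : comNzRingType.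
Implicit Types D : A -> A.

Lemma derivation0 D : derivation D -> D 0 = 0.
Proof.
by case=> DD _; apply: (addrI (D 0)); rewrite -DD !addr0.
Qed.

Lemma derivation1 D : derivation D -> D 1 = 0.
Proof.
case=> _ DM; apply: (addrI (D 1)); rewrite addr0.
by rewrite -[in RHS](mulr1 1) DM mulr1 mul1r.
Qed.

Lemma derivation_sum D I (r : seq I) (P : pred I) (F : I -> A) :
  derivation D -> D (\sum_(i <- r | P i) F i) = \sum_(i <- r | P i) D (F i).
Proof.
by move=> dD; apply: (big_morph D dD.1 (derivation0 dD)).
Qed.

Lemma derivationN D x : derivation D -> D (- x) = - D x.
Proof.
move=> dD; apply: (addrI (D x)).
by rewrite -dD.1 !subrr derivation0.
Qed.

Lemma derivation_opp D : derivation D -> derivation (fun p => - D p).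
Proof.
move=> [DD DM]; split=> p q; rewrite ?DD ?DM; ring.
Qed.

Lemma derivation_commutator D D' : derivation D -> derivation D' ->
  derivation (fun p => D (D' p) - D' (D p)).
Proof.
move=> dD dD'; have [DD DM] := dD; have [DD' DM'] := dD'.
by split=> p q; rewrite ?DD' ?DD ?DD' ?DM ?DM' ?DD ?DD' ?DM ?DM'; ring.
Qed.

Lemma derivation_map_poly D : derivation D -> derivation (map_poly D).
Proof.
move=> dD; have [DD DM] := dD; have D0 := derivation0 dD.
split=> p q; apply/polyP=> i; rewrite !(coef_map_id0, coefD) //.
rewrite !coefM (derivation_sum _ _ _ dD) -big_split /=.
by apply: eq_bigr => j _; rewrite DM !coef_map_id0.
Qed.

Lemma derivation_deriv : derivation (@deriv A).
Proof. by split=> p q; rewrite ?derivD ?derivM. Qed.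

End Derivations.

Section GroupAlgebra.
Variable K : comNzRingType.
Local Notation A := (grpalg K).

Lemma ga_degD : {morph @ga_deg K : x y / x + y}.
Proof.
have degw (d : {fset int}) (x : A) : (msupp x `<=` d)%fset ->
    ga_deg x = \sum_(l <- d) << x@_l * l%:~R *g l >>.
  move=> le; apply: (big_fset_incl _ le) => l _ /mcoeff_outdom ->.
  by rewrite mul0r monalgU0.
move=> x y; pose d := (msupp x `|` msupp y)%fset.
rewrite !(degw d) ?fsubsetUl ?fsubsetUr ?msuppD_le //.
rewrite -big_split /=; apply: eq_bigr => l _.
by rewrite mcoeffD mulrDl monalgUD.
Qed.

(** Elements are finite sums of monomials, so additivity reduces statements on
    the group algebra to monomials. *)
Lemma ga_ind (P : A -> Prop) :
  P 0 -> (forall x y, P x -> P y -> P (x + y)) ->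
  (forall c l, P << c *g l >>) ->
  forall x, P x.
Proof. by move=> P0 PD PU x; rewrite [x]ga_sumE; apply: big_ind. Qed.

Lemma gaUM (a b : K) k l :
  (<< a *g k >> : A) * << b *g l >> = << a * b *g k + l >>.
Proof. exact: ga_mulUU. Qed.

Lemma derivation_ga_deg : derivation (@ga_deg K).
Proof.
split; first exact: ga_degD.
have ga_deg0 : @ga_deg K 0 = 0.
  by apply: (addrI (ga_deg 0)); rewrite -ga_degD !addr0.
move=> x y; elim/ga_ind: x => [|x x' IH IH'|a k].
- by rewrite !(mul0r, ga_deg0) add0r.
- by rewrite mulrDl !ga_degD IH IH'; ring.
elim/ga_ind: y => [|y y' IH IH'|b l].
- by rewrite !(mulr0, ga_deg0) add0r.
- by rewrite mulrDr !ga_degD IH IH'; ring.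
rewrite gaUM !ga_degU !gaUM -monalgUD; congr (<< _ *g _ >>).
by rewrite intrD; ring.
Qed.

End GroupAlgebra.

Section Fock.
Variable K : comNzRingType.
Local Notation F := (fock K).

Lemma fock_scaleE (c : K) (p : F) : c *: p = fock_const << c *g 0 >> * p.
Proof.
rewrite [LHS]/(fock_scale c p) /fock_scale; congr (fock_const _ * _).
by rewrite ga_scaleE [LHS]gaUM mulr1 addr0.
Qed.

Lemma one_D k l : one_ (k + l) = one_ k * one_ l :> F.
Proof. by rewrite /one_ -fock_constM gaUM mulr1. Qed.

Lemma one_0 : one_ 0 = 1 :> F.
Proof. exact: fock_const1. Qed.

Lemma fock_constU c l : fock_const << c *g l >> = c *: one_ l :> F.
Proof. by rewrite fock_scaleE -fock_constM gaUM mulr1 add0r. Qed.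

(** The nested encoding C[P][betab][beta] is unfolded here once: coefficients
    are extracted twice, and the remaining element of C[P] is a sum of
    monomials. *)
Lemma fock_ind (P : F -> Prop) :
  P 0 -> (forall p q, P p -> P q -> P (p + q)) ->
  (forall c m n l, P (c *: (beta ^+ m * betab ^+ n * one_ l))) ->
  forall p, P p.
Proof.
move=> P0 PD PM p.
have -> : p = \sum_(i < size p) \sum_(j < size p`_i)
   fock_const p`_i`_j * betab ^+ j * beta ^+ i.
  rewrite -[LHS](@coefK _ p) poly_def; apply: eq_bigr => i _.
  rewrite -mul_polyC -mulr_suml; congr (_ * _).
  rewrite -[p`_i in LHS]coefK poly_def rmorph_sum /=; apply: eq_bigr => j _.
  by rewrite -mul_polyC rmorphM rmorphXn /= fock_const.unlock.
apply: big_ind => // i _; apply: big_ind => // j _.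
elim/ga_ind: (p`_i`_j) => [|x y Px Py|c l].
- by rewrite fock_const.unlock !polyC0 !mul0r.
- by rewrite fock_constD !mulrDl; exact: PD.
- rewrite fock_constU -!scalerAl.
  rewrite (_ : one_ l * _ * _ = beta ^+ i * betab ^+ j * one_ l) //; ring.
Qed.

Lemma one_gen l : exists n,
  one_ l = one_ 1 ^+ n :> F \/ one_ l = one_ (- 1) ^+ n :> F.
Proof.
have one_X k n : one_ k ^+ n = one_ (k * n%:Z) :> F.
  elim: n => [|n IHn]; first by rewrite mulr0 one_0.
  by rewrite exprS IHn -one_D -addn1 PoszD addrC mulrDr mulr1.
case: l => n; first by exists n; left; rewrite one_X mul1r.
by exists n.+1; right; rewrite one_X mulN1r NegzE.
Qed.

(** Monomials are products of powers of the four generators, the inverse of 1_1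
    being needed to reach 1_l with l < 0. *)
Lemma fock_alg_ind (P : F -> Prop) :
  (forall p q, P p -> P q -> P (p + q)) ->
  (forall p q, P p -> P q -> P (p * q)) ->
  (forall c, P (c%:A)) ->
  P beta -> P betab -> P (one_ 1) -> P (one_ (- 1)) -> forall p, P p.
Proof.
move=> PD PM PC Pb Pbb P1 P1'; have PX p n : P p -> P (p ^+ n).
  move=> Pp; elim: n => [|n IHn]; last by rewrite exprS; exact: PM.
  by rewrite expr0 -(scale1r 1).
apply: fock_ind => //.
  by rewrite -(scale0r 1).
move=> c m n l; rewrite -mulr_algl; apply: (PM) => //.
apply: (PM); first by apply: (PM); exact: PX.
by have [k [->|->]] := one_gen l; exact: PX.
Qed.

(** Leibniz rule applied to 1_1 1_(-1) = 1. *)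
Lemma derivation_oneV (D : F -> F) : derivation D ->
  D (one_ (- 1)) = - one_ (- 1) ^+ 2 * D (one_ 1).
Proof.
move=> dD; have := derivation1 dD.
rewrite -one_0 -[X in one_ X](subrr 1) one_D dD.2 => /eqP.
rewrite addrC addr_eq0 => /eqP h.
rewrite -[LHS]mul1r -one_0 -[X in one_ X](addNr 1) one_D -mulrA h; ring.
Qed.

(** By [derivation_oneV] the value on 1_(-1) follows from the value on 1_1, so
    the Leibniz rule propagates the equality from three generators to the whole
    algebra. *)
Lemma derivation_eq (D D' : F -> F) :
  derivation D -> derivation D' ->
  (forall c, D (c%:A) = 0) -> (forall c, D' (c%:A) = 0) ->
  D beta = D' beta -> D betab = D' betab -> D (one_ 1) = D' (one_ 1) ->
  forall p, D p = D' p.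
Proof.
move=> dD dD' DC DC' eb ebb e1.
apply: fock_alg_ind => //.
- by move=> p q ep eq; rewrite dD.1 dD'.1 ep eq.
- by move=> p q ep eq; rewrite dD.2 dD'.2 ep eq.
- by move=> c; rewrite DC DC'.
- by rewrite derivation_oneV // (derivation_oneV dD') e1.
Qed.

Lemma derivation_gam : derivation (@gam K).
Proof. exact/derivation_opp/derivation_deriv. Qed.

Lemma derivation_gamb : derivation (@gamb K).
Proof. exact/derivation_opp/derivation_map_poly/derivation_deriv. Qed.

Lemma derivation_aop : derivation (@aop K).
Proof. exact/derivation_map_poly/derivation_map_poly/derivation_ga_deg. Qed.

Lemma gam_beta : gam beta = -1 :> F.
Proof. by rewrite /gam /beta derivX. Qed.

Lemma gam_betab : gam betab = 0 :> F.
Proof. by rewrite /gam /betab derivC oppr0. Qed.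

Lemma gam_const x : gam (fock_const x) = 0 :> F.
Proof. by rewrite /gam fock_const.unlock derivC oppr0. Qed.

Lemma map_poly_id0C (A B : nzRingType) (f : A -> B) (a : A) :
  f 0 = 0 -> map_poly f a%:P = (f a)%:P.
Proof.
by move=> f0; apply/polyP => i; rewrite coef_map_id0 // !coefC; case: eqP.
Qed.

Lemma map_poly_id0X (A B : nzRingType) (f : A -> B) :
  f 0 = 0 -> map_poly f 'X = f 1 *: 'X.
Proof.
move=> f0; apply/polyP => i; rewrite coef_map_id0 // coefZ !coefX.
by case: eqP; rewrite ?mulr1 ?mulr0.
Qed.

Lemma gamb_beta : gamb beta = 0 :> F.
Proof.
rewrite /gamb /beta map_poly_id0X ?deriv0 //.
by rewrite (derivation1 (derivation_deriv _)) scale0r oppr0.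
Qed.

Lemma gamb_betab : gamb betab = -1 :> F.
Proof. rewrite /gamb; apply: congr1.
rewrite /betab map_poly_id0C ?deriv0 // derivX.
exact: polyC1. Qed.

Lemma gamb_const x : gamb (fock_const x) = 0 :> F.
Proof.
by rewrite /gamb fock_const.unlock map_poly_id0C ?deriv0 // derivC polyC0 oppr0.
Qed.

Lemma ga_deg0 : @ga_deg K 0 = 0.
Proof. exact: derivation0 (derivation_ga_deg K). Qed.

Lemma ga_deg1 : @ga_deg K 1 = 0.
Proof. exact: derivation1 (derivation_ga_deg K). Qed.

Lemma aop_beta : aop beta = 0 :> F.
Proof.
have d := derivation_map_poly (derivation_ga_deg K).
by rewrite /aop /beta map_poly_id0X ?(derivation0 d) // (derivation1 d) scale0r.
Qed.

Lemma aop_betab : aop betab = 0 :> F.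
Proof.
have d := derivation_map_poly (derivation_ga_deg K).
rewrite /aop /betab map_poly_id0C ?(derivation0 d) //.
by rewrite map_poly_id0X ?ga_deg0 // ga_deg1 scale0r polyC0.
Qed.

Lemma aop_const x : aop (fock_const x) = fock_const (ga_deg x) :> F.
Proof.
by rewrite /aop fock_const.unlock !map_poly_id0C ?ga_deg0.
Qed.
End Fock.

(** * The vector fields of the two copies of sl2 *)

(** The bracket computations are carried out in an arbitrary commutative algebra
    with elements b, bb, s in the roles of beta, betab, 1_(-2) and derivations
    g, h, d in the roles of gamma, gammab, a.  Over this abstract algebra the
    resulting polynomial identities are decided by [ring]. *)
Section VectorFields.
Variables (K : comNzRingType) (A : comAlgType K).
Local Notation L := (sl2 K * sl2 K)%type.
Variables (b bb s : A) (g h d : A -> A).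

(** A head constant for scalars, so that [ring] treats each of them as an atom
    instead of comparing matrix entries up to conversion. *)
Definition scal (c : K) : A := c%:A.

Lemma scalM x y : scal (x * y) = scal x * scal y.
Proof. by rewrite /scal mulr_algl scalerA. Qed.

Lemma scalD x y : scal (x + y) = scal x + scal y.
Proof. exact: scalerDl. Qed.

Lemma scalN x : scal (- x) = - scal x.
Proof. exact: scaleNr. Qed.

Lemma scal_two x : scal (2 * x) = 2 * scal x.
Proof. by rewrite !mulr_natl !mulr2n scalD. Qed.

Lemma scal0 : scal 0 = 0.
Proof. exact: scale0r. Qed.

Lemma scal1 : scal 1 = 1.
Proof. exact: scale1r. Qed.

Lemma scal_scale c (x : A) : c *: x = scal c * x.
Proof. by rewrite /scal mulr_algl. Qed.

Local Ltac scal_ring :=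
  repeat match goal with |- context [scal ?c] => generalize (scal c); intro end;
  ring.

(** Coefficient of gamma: the left copy contributes u01 + 2 u00 b - u10 b^2, and
    the right copy enters only through the term 1_(-2) gamma of its f. *)
Definition vf_gam (w : L) : A :=
  scal (w.1 0 1) + 2 * scal (w.1 0 0) * b
  - scal (w.1 1 0) * b ^+ 2 + scal (w.2 1 0) * s.
Definition vf_gamb (w : L) : A :=
  scal (w.2 0 1) + 2 * scal (w.2 0 0) * bb
  - scal (w.2 1 0) * bb ^+ 2 + scal (w.1 1 0) * s.
Definition vf_a (w : L) : A :=
  scal (w.1 0 0) - scal (w.1 1 0) * b
  + scal (w.2 0 0) - scal (w.2 1 0) * bb.

Definition vf (w : L) (p : A) : A :=
  vf_gam w * g p + vf_gamb w * h p + vf_a w * d p.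

Section Evaluation.
Variable ev : A -> K.
Hypotheses (evD : forall x y, ev (x + y) = ev x + ev y).
Hypotheses (evN : forall x, ev (- x) = - ev x).
Hypotheses (evM : forall x y, ev (x * y) = ev x * ev y).
Hypotheses (evZ : forall c, ev (c%:A) = c).

Let ev_scal c : ev (scal c) = c := evZ c.

Lemma ev_two x : ev (2 * x) = 2 * ev x.
Proof. by rewrite !mulr_natl !mulr2n evD. Qed.

(** These three lemmas compute the coefficients at a point, ev being the
    evaluation there. *)
Lemma ev_vf_gam w : ev (vf_gam w) =
  w.1 0 1 + 2 * w.1 0 0 * ev b - w.1 1 0 * ev b ^+ 2 + w.2 1 0 * ev s.
Proof. by rewrite /vf_gam -!mulrA expr2 !(evD, evN, ev_two, evM, ev_scal). Qed.

Lemma ev_vf_gamb w : ev (vf_gamb w) =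
  w.2 0 1 + 2 * w.2 0 0 * ev bb - w.2 1 0 * ev bb ^+ 2 + w.1 1 0 * ev s.
Proof. by rewrite /vf_gamb -!mulrA expr2 !(evD, evN, ev_two, evM, ev_scal). Qed.

Lemma ev_vf_a w : ev (vf_a w) =
  w.1 0 0 - w.1 1 0 * ev b + w.2 0 0 - w.2 1 0 * ev bb.
Proof. by rewrite /vf_a !(evD, evN, evM, ev_scal). Qed.

End Evaluation.

Hypotheses (dg : derivation g) (dh : derivation h) (dd : derivation d).
Hypothesis gC : forall c, g (scal c) = 0.
Hypothesis hC : forall c, h (scal c) = 0.
Hypothesis dC : forall c, d (scal c) = 0.

Lemma derivation_vf w : derivation (vf w).
Proof.
have [gD gM] := dg; have [hD hM] := dh; have [aD aM] := dd.
by split=> p q; rewrite /vf ?gD ?hD ?aD ?gM ?hM ?aM; ring.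
Qed.

Lemma vf_scalar w c : vf w (scal c) = 0.
Proof. by rewrite /vf gC hC dC !mulr0 !addr0. Qed.

Lemma vf_scale w c p : vf w (c *: p) = c *: vf w p.
Proof.
by rewrite !scal_scale (derivation_vf w).2 vf_scalar mul0r add0r.
Qed.

Lemma sl2_entry_linear (a : K) (u v : sl2 K) i j :
  (a *: u + v) i j = a * u i j + v i j.
Proof. by rewrite !mxE. Qed.

Lemma vf_linear_l p : linear (vf^~ p).
Proof.
move=> a [u v] [u' v']; rewrite [X in _ = X + _]scal_scale.
rewrite -[a *: (u, v) + (u', v')]/((a *: u + u', a *: v + v') : L).
rewrite /vf /vf_gam /vf_gamb /vf_a /fst /snd.
rewrite 3!(sl2_entry_linear a u u') 3!(sl2_entry_linear a v v').
rewrite !scalD !scalM.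
scal_ring.
Qed.

Lemma vf_left_e p : vf (sl2_e, 0) p = g p.
Proof.
rewrite /vf /vf_gam /vf_gamb /vf_a /= !mxE /= !(scal0, scal1); ring.
Qed.

Lemma vf_left_h p : vf (sl2_h, 0) p = 2 * b * g p + d p.
Proof.
rewrite /vf /vf_gam /vf_gamb /vf_a /= !mxE /= !(scal0, scal1); ring.
Qed.

Lemma vf_left_f p : vf (sl2_f, 0) p = - b ^+ 2 * g p - b * d p + s * h p.
Proof.
rewrite /vf /vf_gam /vf_gamb /vf_a /= !mxE /= !(scal0, scal1); ring.
Qed.

Lemma vf_right_e p : vf (0, sl2_e) p = h p.
Proof.
rewrite /vf /vf_gam /vf_gamb /vf_a /= !mxE /= !(scal0, scal1); ring.
Qed.

Lemma vf_right_h p : vf (0, sl2_h) p = 2 * bb * h p + d p.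
Proof.
rewrite /vf /vf_gam /vf_gamb /vf_a /= !mxE /= !(scal0, scal1); ring.
Qed.

Lemma vf_right_f p : vf (0, sl2_f) p = - bb ^+ 2 * h p - bb * d p + s * g p.
Proof.
rewrite /vf /vf_gam /vf_gamb /vf_a /= !mxE /= !(scal0, scal1); ring.
Qed.

Hypotheses (gb : g b = -1) (gbb : g bb = 0) (gs : g s = 0).
Hypotheses (hb : h b = 0) (hbb : h bb = -1) (hs : h s = 0).
Hypotheses (db : d b = 0) (dbb : d bb = 0) (ds : d s = - 2 * s).

Lemma vf_b w : vf w b = - vf_gam w.
Proof. by rewrite /vf gb hb db; ring. Qed.

Lemma vf_bb w : vf w bb = - vf_gamb w.
Proof. by rewrite /vf gbb hbb dbb; ring. Qed.

Lemma vf_s w : vf w s = - 2 * vf_a w * s.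
Proof. by rewrite /vf gs hs ds; ring. Qed.

Lemma vf_t w t : g t = 0 -> h t = 0 -> d t = t -> vf w t = vf_a w * t.
Proof. by move=> gt ht dt; rewrite /vf gt ht dt; ring. Qed.

Lemma vf_two w x : vf w (2 * x) = 2 * vf w x.
Proof. by rewrite !mulr_natl !mulr2n (derivation_vf w).1. Qed.

Lemma vf_scalarM w c x : vf w (scal c * x) = scal c * vf w x.
Proof. by rewrite (derivation_vf w).2 vf_scalar mul0r add0r. Qed.

Lemma sl2_11 (u : sl2 K) : u 1 1 = - u 0 0.
Proof.
case: u => m /= /eqP tm; apply/eqP; rewrite -addr_eq0 addrC -tm.
by rewrite /mxtrace !big_ord_recl big_ord0 addr0; apply/eqP; congr (_ + m _ _);
  exact: val_inj.
Qed.

Lemma mulmx2 (m n : 'M[K]_2) i j :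
  (m *m n) i j = m i 0 * n 0 j + m i 1 * n 1 j.
Proof.
rewrite mxE !big_ord_recl big_ord0 addr0.
by congr (_ + m _ _ * n _ _); exact: val_inj.
Qed.

(** The remaining entry is minus the first one by [sl2_11]. *)
Lemma sl2_bracketE (u v : sl2 K) :
  [/\ sl2_bracket u v 0 0 = u 0 1 * v 1 0 - v 0 1 * u 1 0,
      sl2_bracket u v 0 1 = 2 * (u 0 0 * v 0 1 - v 0 0 * u 0 1)
    & sl2_bracket u v 1 0 = 2 * (u 1 0 * v 0 0 - v 1 0 * u 0 0)].
Proof.
by split; rewrite /= [LHS]mxE [X in _ + X]mxE !mulmx2 ?sl2_11; ring.
Qed.

Let vfD w := (derivation_vf w).1.
Let vfM w := (derivation_vf w).2.
Let vfN w x : vf w (- x) = - vf w x := derivationN x (derivation_vf w).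

(** The three lemmas [vf_bracket_b], [vf_bracket_bb] and [vf_bracket_t] are the
    bracket identity on the generators beta, betab and 1_1, to which
    [derivation_eq] reduces it. *)
Lemma vf_bracket_b w w' :
  vf (sl2x2_bracket w w') b = vf w (vf w' b) - vf w' (vf w b).
Proof.
have [e00 e01 e10] := sl2_bracketE w.1 w'.1.
have [f00 f01 f10] := sl2_bracketE w.2 w'.2.
rewrite !vf_b !vfN {1}/vf_gam /= e00 e01 e10 f10.
rewrite !(scalD, scalN, scal_two, scalM) /vf_gam -!mulrA.
rewrite !(vfD, vfN, vf_two, vf_scalarM, expr2, vfM, vf_b, vf_s, vf_scalar).
rewrite /vf_gam /vf_a; scal_ring.
Qed.

Lemma vf_bracket_bb w w' :
  vf (sl2x2_bracket w w') bb = vf w (vf w' bb) - vf w' (vf w bb).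
Proof.
have [e00 e01 e10] := sl2_bracketE w.1 w'.1.
have [f00 f01 f10] := sl2_bracketE w.2 w'.2.
rewrite !vf_bb !vfN {1}/vf_gamb /= f00 f01 f10 e10.
rewrite !(scalD, scalN, scal_two, scalM) /vf_gamb -!mulrA.
rewrite !(vfD, vfN, vf_two, vf_scalarM, expr2, vfM, vf_bb, vf_s, vf_scalar).
rewrite /vf_gamb /vf_a; scal_ring.
Qed.

Lemma vf_bracket_t t w w' : g t = 0 -> h t = 0 -> d t = t ->
  vf (sl2x2_bracket w w') t = vf w (vf w' t) - vf w' (vf w t).
Proof.
move=> gt ht dt; have vft v := vf_t v gt ht dt.
have [e00 e01 e10] := sl2_bracketE w.1 w'.1.
have [f00 f01 f10] := sl2_bracketE w.2 w'.2.
rewrite !vft !vfM !vft {1}/vf_a /= e00 f00 e10 f10.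
rewrite !(scalD, scalN, scal_two, scalM) /vf_a.
rewrite !(vfD, vfN, vf_scalarM, vf_b, vf_bb, vf_scalar).
rewrite /vf_gam /vf_gamb; scal_ring.
Qed.

End VectorFields.

Section Rho.
Variable K : comNzRingType.
Local Notation F := (fock K).

Definition rho : sl2 K * sl2 K -> F -> F :=
  vf beta betab (one_ (- 2)) (@gam K) (@gamb K) (@aop K).

Lemma scalar_const (c : K) : c%:A = fock_const << c *g 0 >> :> F.
Proof. by rewrite fock_constU one_0. Qed.

Lemma gam_scalar (c : K) : gam (c%:A) = 0 :> F.
Proof. by rewrite scalar_const gam_const. Qed.

Lemma gamb_scalar (c : K) : gamb (c%:A) = 0 :> F.
Proof. by rewrite scalar_const gamb_const. Qed.

Lemma aop_one l : aop (one_ l) = l%:~R * one_ l :> F.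
Proof.
rewrite /one_ aop_const ga_degU mul1r fock_constU -mulr_algl; congr (_ * _).
exact: (rmorph_int (in_alg F)).
Qed.

Lemma aop_scalar (c : K) : aop (c%:A) = 0 :> F.
Proof.
rewrite scalar_const aop_const ga_degU [c * _]mulr0 monalgU0.
by rewrite fock_const.unlock !polyC0.
Qed.

Lemma gam_one l p : gam (one_ l * p) = one_ l * gam p :> F.
Proof. by rewrite (derivation_gam K).2 gam_const mul0r add0r. Qed.

Lemma gamb_one l p : gamb (one_ l * p) = one_ l * gamb p :> F.
Proof. by rewrite (derivation_gamb K).2 gamb_const mul0r add0r. Qed.

Lemma derivation_rho w : derivation (rho w).
Proof.
exact: derivation_vf (derivation_gam K) (derivation_gamb K)
  (derivation_aop K) w.
Qed.

Lemma rho_scalar w c : rho w (c%:A) = 0.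
Proof. exact: vf_scalar gam_scalar gamb_scalar aop_scalar w c. Qed.

Lemma rho_scale w c p : rho w (c *: p) = c *: rho w p.
Proof.
exact: (vf_scale _ _ _ (derivation_gam K) (derivation_gamb K) (derivation_aop K)
  gam_scalar gamb_scalar aop_scalar w c).
Qed.

(** Both sides are derivations that kill the scalars, the right-hand one because
    a commutator of derivations is a derivation. *)
Lemma rho_bracket w w' p :
  rho (sl2x2_bracket w w') p = rho w (rho w' p) - rho w' (rho w p).
Proof.
have dg := derivation_gam K; have dh := derivation_gamb K.
have da := derivation_aop K.
have a2 : aop (one_ (- 2)) = - 2 * one_ (- 2) :> F by rewrite aop_one mulrNz.
have gs := gam_const (<< - 2 >> : grpalg K).
have hs := gamb_const (<< - 2 >> : grpalg K).
have d := derivation_commutator (derivation_rho w) (derivation_rho w').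
apply: (derivation_eq (derivation_rho (sl2x2_bracket w w')) d).
- by move=> c; exact: rho_scalar.
- by move=> c; rewrite !rho_scalar !(derivation0 (derivation_rho _)) subrr.
- exact: (vf_bracket_b betab dg dh da gam_scalar gamb_scalar aop_scalar
    (gam_beta K) gs (gamb_beta K) hs (aop_beta K) a2).
- exact: (vf_bracket_bb beta dg dh da gam_scalar gamb_scalar aop_scalar
    (gam_betab K) gs (gamb_betab K) hs (aop_betab K) a2).
- apply: (vf_bracket_t (one_ (- 2)) dg dh da gam_scalar gamb_scalar aop_scalar
    (gam_beta K) (gam_betab K) (gamb_beta K) (gamb_betab K)
    (aop_beta K) (aop_betab K)).
  + exact: gam_const.
  + exact: gamb_const.
  + by rewrite aop_one mul1r.
Qed.

Lemma rho_beta w : rho w beta = - vf_gam beta (one_ (- 2)) w :> F.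
Proof. exact: vf_b (gam_beta K) (gamb_beta K) (aop_beta K) w. Qed.

Lemma rho_betab w : rho w betab = - vf_gamb betab (one_ (- 2)) w :> F.
Proof. exact: vf_bb (gam_betab K) (gamb_betab K) (aop_betab K) w. Qed.

Lemma rho_one w : rho w (one_ 1) = vf_a beta betab w * one_ 1.
Proof.
apply: vf_t; [exact: gam_const | exact: gamb_const |].
by rewrite aop_one mul1r.
Qed.

Lemma rho_lie_module : lie_module (@sl2x2_bracket K) rho.
Proof.
split=> [w c p q|p|]; last exact: rho_bracket.
  by rewrite (derivation_rho w).1 rho_scale.
exact: vf_linear_l.
Qed.

End Rho.

(** * Universal property of the Fock space *)

(** Like polynomials and Laurent polynomials, the Fock space is freely generated
    as a commutative algebra by beta, betab and the invertible element 1_1; a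
    morphism u from the integers to the multiplicative monoid of B encodes the
    image of the latter with its powers. *)
Section Lift.
Variables (K : comNzRingType) (B : comAlgType K).
Variables (x y : B) (u : int -> B).
Hypotheses (u0 : u 0 = 1) (uD : forall k l, u (k + l) = u k * u l).
Local Notation F := (fock K).

Definition ga_lift : grpalg K -> B := mmap (in_alg B) u.

Lemma ga_lift_zmod : zmod_morphism ga_lift.
Proof. by move=> p q; rewrite /ga_lift raddfB. Qed.

Lemma ga_liftU c l : ga_lift << c *g l >> = c *: u l.
Proof. by rewrite /ga_lift mmapU mulr_algl. Qed.

Lemma ga_lift_monoid : monoid_morphism ga_lift.
Proof.
have lD p q : ga_lift (p + q) = ga_lift p + ga_lift q.
  by rewrite /ga_lift raddfD.
have l0 : ga_lift 0 = 0 by rewrite /ga_lift raddf0.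
split; first by rewrite ga_liftU scale1r.
move=> p q; elim/ga_ind: p => [|p p' IH IH'|a k].
- by rewrite mul0r l0 mul0r.
- by rewrite mulrDl !lD IH IH' mulrDl.
elim/ga_ind: q => [|q q' IH IH'|b l].
- by rewrite mulr0 l0 mulr0.
- by rewrite mulrDr !lD IH IH' mulrDr.
by rewrite gaUM !ga_liftU uD -scalerAl -scalerAr scalerA.
Qed.

HB.instance Definition _ :=
  GRing.isZmodMorphism.Build (grpalg K) B ga_lift ga_lift_zmod.
HB.instance Definition _ :=
  GRing.isMonoidMorphism.Build (grpalg K) B ga_lift ga_lift_monoid.

Definition fock_lift : F -> B :=
  horner_morph (fun a => mulrC x
    (horner_morph (fun b => mulrC y (ga_lift b)) a)).

Lemma fock_lift_const a : fock_lift (fock_const a) = ga_lift a.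
Proof.
by rewrite fock_const.unlock /fock_lift horner_morphC /= horner_morphC.
Qed.

Lemma fock_lift_beta : fock_lift beta = x.
Proof. exact: horner_morphX. Qed.

Lemma fock_lift_betab : fock_lift betab = y.
Proof. by rewrite /fock_lift horner_morphC /= horner_morphX. Qed.

Lemma fock_lift_zmod : zmod_morphism fock_lift.
Proof. by move=> p q; rewrite /fock_lift rmorphB. Qed.

Lemma fock_lift_monoid : monoid_morphism fock_lift.
Proof.
by split=> [|p q]; [exact: rmorph1 | rewrite /fock_lift -rmorphM].
Qed.

Lemma fock_lift_scalable : scalable fock_lift.
Proof.
move=> c p; rewrite fock_scaleE fock_lift_monoid.2 fock_lift_const ga_liftU.
by rewrite u0 mulr_algl.
Qed.

HB.instance Definition _ :=
  GRing.isZmodMorphism.Build F B fock_lift fock_lift_zmod.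
HB.instance Definition _ :=
  GRing.isMonoidMorphism.Build F B fock_lift fock_lift_monoid.
HB.instance Definition _ :=
  GRing.isScalable.Build K F B *:%R fock_lift fock_lift_scalable.

Lemma fock_universal : exists Phi : {lrmorphism F -> B},
  [/\ Phi beta = x, Phi betab = y & forall l, Phi (one_ l) = u l].
Proof.
exists fock_lift; split; [exact: fock_lift_beta|exact: fock_lift_betab|].
by move=> l; rewrite [LHS]fock_lift_const ga_liftU scale1r.
Qed.
End Lift.

(** * Laurent polynomials that vanish as functions *)

Section Vanishing.
Variable K : numFieldType.

(** The images of the natural numbers are distinct, so a non-zero polynomial
    would have more roots than its size allows. *)
Lemma poly_fun0 (q : {poly K}) : (forall x, q.[x] = 0) -> q = 0.
Proof.
move=> q0; apply/eqP/negPn/negP => qn0.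
suff: (size q < size q)%N by rewrite ltnn.
rewrite -[X in (X < _)%N](size_iota 0) -(size_map (fun n => n%:R : K)).
apply: max_poly_roots => //.
  by apply/allP => _ /mapP[n _ ->]; apply/rootP.
by rewrite map_inj_uniq ?iota_uniq // => m n /eqP; rewrite eqr_nat => /eqP.
Qed.

Definition laurent_eval (z : K) (a : grpalg K) : K :=
  mmap idfun (fun l : int => z ^ l) a.

Lemma laurent_evalD z : {morph laurent_eval z : a b / a + b}.
Proof. by move=> a b; rewrite /laurent_eval raddfD. Qed.

Lemma laurent_eval0 z : laurent_eval z 0 = 0.
Proof. exact: raddf0. Qed.

(** Multiplying by a large power z^N clears the negative exponents and leaves a
    polynomial; a further factor z makes it vanish at 0 as well, so
    [poly_fun0] applies. *)
Lemma laurent_fun0 (a : grpalg K) :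
  (forall z, z != 0 -> laurent_eval z a = 0) -> a = 0.
Proof.
move=> a0; pose N := (\sum_(l <- msupp a) `|l|)%N.
have suppN l : l \in msupp a -> 0 <= l + N%:Z.
  move=> la; have : (`|l| <= N)%N.
    by rewrite /N (big_rem l) //= leq_addr.
  by case: l la => n _ // nN; rewrite NegzE addrC subr_ge0 lez_nat.
pose q : {poly K} := \sum_(l <- msupp a) a@_l *: 'X^(absz (l + N%:Z)).
have qz z : z != 0 -> q.[z] = 0.
  move=> z0; have := congr1 ( *%R^~ (z ^+ N)) (a0 z z0); rewrite mul0r => <-.
  rewrite /laurent_eval /mmap mulr_suml /q horner_sum !big_seq.
  apply: eq_bigr => l la.
  rewrite hornerZ hornerXn /= -mulrA; congr (_ * _).
  by rewrite !exprnP gez0_abs ?suppN // expfzDr.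
have q0 : q = 0.
  have : q * 'X = 0.
    apply: poly_fun0 => z; rewrite hornerMX.
    by have [->|/qz ->] := eqVneq z 0; rewrite ?mulr0 ?mul0r.
  by move=> /eqP; rewrite mulf_eq0 polyX_eq0 orbF => /eqP.
apply/malgP => k; rewrite mcoeff0.
have [ka|] := boolP (k \in msupp a); last by move=> /mcoeff_outdom.
have : q`_(absz (k + N%:Z)) = 0 by rewrite q0 coef0.
rewrite /q coef_sum (bigD1_seq k) ?fset_uniq //= coefZ coefXn eqxx mulr1.
rewrite big_seq_cond big1 ?addr0 // => l /andP[la lk].
rewrite coefZ coefXn; case: eqP => [e|]; last by rewrite mulr0.
case/eqP: lk; apply/eqP; rewrite -(inj_eq (addIr N%:Z)); apply/eqP.
by rewrite -(gez0_abs (suppN _ la)) -(gez0_abs (suppN _ ka)) e.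
Qed.

(** Evaluation at x, y, z written through iterated Horner evaluations, so that
    the variables can be eliminated one at a time in [fock_eval_inj]. *)
Definition fock_eval (x y z : K) (p : fock K) : K :=
  (map_poly (fun q : {poly grpalg K} =>
     (map_poly (laurent_eval z) q).[- y]) p).[x].

Lemma map_polyD_id0 (A B : nzRingType) (f : A -> B) p q :
  f 0 = 0 -> {morph f : x y / x + y} ->
  map_poly f (p + q) = map_poly f p + map_poly f q.
Proof.
by move=> f0 fD; apply/polyP => i; rewrite !(coefD, coef_map_id0) // fD.
Qed.

Lemma map_polyCXn (A B : nzRingType) (f : A -> B) a n :
  f 0 = 0 -> map_poly f (a%:P * 'X^n) = (f a)%:P * 'X^n.
Proof.
move=> f0; apply/polyP => i; rewrite coef_map_id0 // !coefCM !coefXn.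
by case: eqP; rewrite ?mulr1 ?mulr0.
Qed.

Lemma fock_evalD x y z : {morph fock_eval x y z : p q / p + q}.
Proof.
move=> p q; rewrite /fock_eval map_polyD_id0 ?hornerD //.
  by rewrite map_poly0 horner0.
move=> a b; rewrite map_polyD_id0 ?hornerD ?laurent_eval0 //.
exact: laurent_evalD.
Qed.

Lemma fock_eval0 x y z : fock_eval x y z 0 = 0.
Proof. by rewrite /fock_eval map_poly0 horner0. Qed.

Lemma fock_eval_monomial x y z c m n l :
  fock_eval x y z (c *: (beta ^+ m * betab ^+ n * one_ l))
  = c * (x ^+ m * (- y) ^+ n * z ^ l).
Proof.
have -> : c *: (beta ^+ m * betab ^+ n * one_ l) =
    ((<< c *g l >> : grpalg K)%:P * 'X^n)%:P * 'X^m :> fock K.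
  rewrite scalerAr -fock_constU fock_const.unlock rmorphM rmorphXn /=.
  by rewrite -/betab -/beta; ring.
rewrite /fock_eval map_polyCXn ?map_poly0 ?horner0 //.
rewrite map_polyCXn ?laurent_eval0 // /laurent_eval mmapU /=.
by rewrite !hornerM !hornerXn !hornerC; ring.
Qed.

(** Vanishing for all x kills the polynomial in x, hence each of its
    coefficients; then the same for y, and finally [laurent_fun0] for z. *)
Lemma fock_eval_inj (p : fock K) :
  (forall x y z, z != 0 -> fock_eval x y z p = 0) -> p = 0.
Proof.
move=> ev0; apply/polyP => i; rewrite coef0; apply/polyP => j; rewrite coef0.
apply: laurent_fun0 => z z0.
set f := laurent_eval z; have f0 : f 0 = 0 := laurent_eval0 z.
rewrite -(coef_map_id0 (f := f)) //.
suff -> : map_poly f p`_i = 0 by rewrite coef0.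
apply: poly_fun0 => y; rewrite -[y]opprK.
pose f2 (q : {poly grpalg K}) := (map_poly f q).[- - y].
have f20 : f2 0 = 0 by rewrite /f2 map_poly0 horner0.
rewrite -[LHS]/(f2 p`_i) -(coef_map_id0 (f := f2)) //.
suff -> : map_poly f2 p = 0 by rewrite coef0.
by apply: poly_fun0 => x; exact: ev0.
Qed.

End Vanishing.

(** * Partial sums of the complex exponential *)

(** Both sides sum G over the pairs i, j with i + j < n, on the left by
    antidiagonals. *)
Lemma sum_triangle (V : nmodType) (G : nat -> nat -> V) n :
  \sum_(0 <= k < n) \sum_(0 <= i < k.+1) G i (k - i)%N =
  \sum_(0 <= i < n) \sum_(0 <= j < (n - i)%N) G i j.
Proof.
elim: n => [|n IHn]; first by rewrite !big_geq.
rewrite big_nat_recr //= IHn [in RHS]big_nat_recr //= subSn // subnn big_nat1.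
rewrite big_nat_recr //= subnn addrA; congr (_ + _); rewrite -big_split /=.
apply: eq_big_nat => i /andP[_ ltin].
by rewrite subSn 1?ltnW // [in RHS]big_nat_recr.
Qed.

Definition exp_term (K : numFieldType) (x : K) (n : nat) : K :=
  x ^+ n / n`!%:R.

Lemma exp_term_add (K : numFieldType) (x y : K) k :
  (x + y) ^+ k / k`!%:R =
  \sum_(0 <= i < k.+1) x ^+ i / i`!%:R * (y ^+ (k - i) / (k - i)`!%:R).
Proof.
rewrite addrC exprDn mulr_suml big_mkord; apply: eq_bigr => i _.
have ik : (i <= k)%N by rewrite -ltnS.
have nz j : j`!%:R != 0 :> K by rewrite pnatr_eq0 -lt0n fact_gt0.
rewrite -(bin_fact ik) !natrM -mulr_natr.
have binnz : 'C(k, i)%:R != 0 :> K by rewrite pnatr_eq0 -lt0n bin_gt0.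
by field; rewrite !nz binnz.
Qed.

Lemma series_exp_term0 (K : numFieldType) n :
  series (exp_term (0 : K)) n.+1 = 1.
Proof.
rewrite /series /= big_nat_recl //= /exp_term /= expr0 divr1.
by rewrite big1 ?addr0 // => i _; rewrite expr0n mul0r.
Qed.

(** The pairs i + j < n of the product of two partial sums assemble to a partial
    sum at x + y; the others are left as an error term. *)
Lemma exp_partial_mul (K : numFieldType) (x y : K) n :
  series (exp_term x) n * series (exp_term y) n =
  series (exp_term (x + y)) n +
  \sum_(0 <= i < n) \sum_((n - i)%N <= j < n) exp_term x i * exp_term y j.
Proof.
rewrite /series /= /exp_term.
under [in RHS]eq_bigr do rewrite exp_term_add.
rewrite (sum_triangle (fun i j => x ^+ i / i`!%:R * (y ^+ j / j`!%:R))).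
rewrite mulr_suml -big_split /=; apply: eq_bigr => i _.
by rewrite mulr_sumr (@big_cat_nat _ _ _ (n - i)%N) //= leq_subr.
Qed.

Section Complex.
Variable R : realType.
Local Notation C := (cplx R).
Local Open Scope complex_scope.

(** The inclusion of the reals, restated with values in [cplx] so that the
    rewriting lemmas below match the structures of that type. *)
Definition toC (x : R) : C := x%:C.

Lemma toCM x y : toC (x * y) = toC x * toC y.
Proof. exact: (rmorphM (real_complex R)). Qed.

Lemma toCX x n : toC (x ^+ n) = toC x ^+ n.
Proof. exact: (rmorphXn (real_complex R)). Qed.

Lemma toCD x y : toC (x + y) = toC x + toC y.
Proof. exact: (rmorphD (real_complex R)). Qed.

Lemma toCVnat n : toC n%:R^-1 = n%:R^-1.
Proof.
by rewrite /toC fmorphV; congr (_^-1); exact: (rmorph_nat (real_complex R)).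
Qed.

Lemma toC_sum I (r : seq I) P (F : I -> R) :
  toC (\sum_(i <- r | P i) F i) = \sum_(i <- r | P i) toC (F i).
Proof. exact: (rmorph_sum (real_complex R)). Qed.

Lemma toC_le x y : (toC x <= toC y) = (x <= y).
Proof. exact: lecR. Qed.

Lemma toC_norm (z : C) : toC (complex.Re `|z|) = `|z|.
Proof. by apply: RRe_real; exact: normr_real. Qed.

Lemma normC_le_cvg (T : Type) (F : set_system T) {FF : Filter F}
    (u : T -> C) (v : T -> R) (l : C) :
  (forall n, `|l - u n| <= toC (v n)) -> v @ F --> 0 -> u @ F --> l.
Proof.
move=> uv v0; apply/cvgrPdist_lt => e e0.
have [er ei] : (0 < complex.Re e) /\ (complex.Im e = 0).
  by move: e0; rewrite ltcE /= => /andP[/eqP ei er].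
move/cvgrPdist_lt: v0 => /(_ _ er); apply: filterS => n.
rewrite sub0r normrN => vn; apply: le_lt_trans (uv n) _.
rewrite ltcE /= ei eqxx /=; apply: le_lt_trans vn; exact: ler_norm.
Qed.

(** For y = - x the main term of [exp_partial_mul] is 1.  The norm of the error
    term is at most the error term of r = |x| against itself, which by the same
    identity is the difference of partial sums of e^r e^r and e^(2 r), and tends
    to 0. *)
Lemma exp_partialN_cvg (x : C) :
  series (exp_term x) n * series (exp_term (- x)) n @[n --> \oo] --> (1 : C).
Proof.
pose r : R := complex.Re `|x|.
have rE : `|x| = toC r by rewrite toC_norm.
have E i : `|exp_term x i| = toC (exp_term r i).
  rewrite /exp_term /= normrM normrX rE normfV normr_nat.
  by rewrite toCM toCX toCVnat.
have E' i : `|exp_term (- x) i| = toC (exp_term r i).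
  by rewrite -E /exp_term /= !normrM !normrX normrN.
(* v is the error term of exp_partial_mul for r and r. *)
pose v n : R := series (exp_term r) n * series (exp_term r) n
                - series (exp_term (r + r)) n.
pose p n : C := series (exp_term x) n * series (exp_term (- x)) n.
(* The empty partial sum at x + y = 0 is 0, not 1; the shift discards it. *)
rewrite -(cvg_shiftS p) /p /=.
apply: (@normC_le_cvg _ _ _ _ (fun n => v n.+1)).
  move=> n; rewrite exp_partial_mul subrr series_exp_term0.
  rewrite opprD addrA subrr sub0r normrN /v exp_partial_mul addrAC subrr add0r.
  rewrite toC_sum; apply: le_trans (ler_norm_sum _ _ _) _.
  apply: ler_sum => i _; rewrite toC_sum.
  apply: le_trans (ler_norm_sum _ _ _) _.
  by apply: ler_sum => j _; rewrite normrM E E' -toCM lexx.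
suff : v @ \oo --> 0 by rewrite -(cvg_shiftS v).
rewrite (_ : 0 = expR r * expR r - expR (r + r)); last first.
  by rewrite expRD subrr.
have expC y : series (exp_term y) n @[n --> \oo] --> expR y.
  exact: is_cvg_series_exp_coeff.
apply: cvgB; last exact: expC.
by apply: cvgM; exact: expC.
Qed.

(** Completeness enters through R: the real and imaginary parts of the series
    are dominated by v, hence converge. *)
Lemma complex_normed_cvg (u : nat -> C) (v : nat -> R) :
  (forall n, `|u n| <= toC (v n)) -> cvgn (series v) -> cvgn (series u).
Proof.
move=> uv cv.
have part (f : C -> R) : (forall z, `|f z| <= complex.Re `|z|) ->
    cvgn (series (f \o u)).
  move=> fle; apply: normed_cvg; apply: series_le_cvg cv => n //=.
    move: (uv n); rewrite lecE /= => /andP[_]; apply: le_trans.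
    by case: (u n) => a b; rewrite sqrtr_ge0.
  apply: le_trans (fle (u n)) _ => /=.
  by move: (uv n); rewrite lecE => /andP[].
have nE z :
    complex.Re `|z| = Num.sqrt (complex.Re z ^+ 2 + complex.Im z ^+ 2).
  by case: z.
have /cvg_ex[a ca] : cvgn (series (@complex.Re R \o u)).
  apply: part => z; rewrite nE -sqrtr_sqr ler_sqrt ?addr_ge0 ?sqr_ge0 //.
  by rewrite lerDl sqr_ge0.
have /cvg_ex[b cb] : cvgn (series (@complex.Im R \o u)).
  apply: part => z; rewrite nE -sqrtr_sqr ler_sqrt ?addr_ge0 ?sqr_ge0 //.
  by rewrite lerDr sqr_ge0.
apply/cvg_ex; exists (a +i* b).
apply: (@normC_le_cvg _ _ _ _ (fun n => `|a - series (@complex.Re R \o u) n|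
   + `|b - series (@complex.Im R \o u) n|)).
  move=> n.
  have -> : series u n =
      series (@complex.Re R \o u) n +i* series (@complex.Im R \o u) n.
    rewrite /series /=; elim: n => [|n IHn]; first by rewrite !big_geq.
    by rewrite !big_nat_recr //= IHn; case: (u n).
  set a' := series _ n; set b' := series _ n.
  rewrite (_ : _ - _ = (a - a')%:C + 'i * (b - b')%:C); last first.
    by rewrite [LHS]complexE.
  apply: le_trans (ler_normD _ _) _; rewrite toCD; apply: lerD.
    by rewrite normc_def /= expr0n addr0 sqrtr_sqr.
  by rewrite normrM [X in X * _]normc_def /= expr0n expr1n add0r sqrtr1 mul1r
    normc_def /= expr0n addr0 sqrtr_sqr.
rewrite -(addr0 0); apply: cvgD.
  have := cvg_norm (cvgB (cvg_cst a) ca); rewrite subrr normr0; exact.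
have := cvg_norm (cvgB (cvg_cst b) cb); rewrite subrr normr0; exact.
Unshelve. all: by end_near. Qed.

End Complex.

(** * Exponential power series at the origin *)

(** A second-order error term M |t|^2 divided by |t| tends to 0. *)
Lemma is_derive_quadratic (K : numFieldType) (f : K -> K) (f0 d M : K) :
  0 <= M -> (forall t, `|t| <= 1 -> `|f t - (f0 + t * d)| <= `|t| ^+ 2 * M) ->
  f 0 = f0 /\ is_derive (0 : K) 1 f d.
Proof.
move=> M0 fq.
have f0E : f 0 = f0.
  have := fq 0; rewrite normr0 ler01 => /(_ isT).
  by rewrite expr0n !mul0r addr0 normr_le0 subr_eq0 => /eqP.
have cv : h^-1 *: (f (h *: 1 + 0) - f 0) @[h --> 0^'] --> d.
  apply/cvgrPdist_lt => e e0.
  (* M + 1 instead of M keeps the denominator of the radius non-zero. *)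
  have M1 : 0 < M + 1 by rewrite ltr_wpDl.
  near=> h.
  have hn0 : h != 0 by near: h; exact: nbhs_dnbhs_neq.
  have h1 : `|h| <= 1.
    by near: h; apply: nbhs_dnbhs; apply: (@nbhs0_le _ K); exact: ltr01.
  have he : `|h| < e / (M + 1).
    by near: h; apply: nbhs_dnbhs; apply: (@nbhs0_lt _ K); exact: divr_gt0.
  have -> : d - h^-1 *: (f (h *: 1 + 0) - f 0)
            = - (h^-1 * (f h - (f0 + h * d))).
    by rewrite /GRing.scale /= mulr1 addr0 f0E; field.
  rewrite normrN normrM normfV.
  apply: le_lt_trans (_ : `|h|^-1 * (`|h| ^+ 2 * M) < e).
    by rewrite ler_wpM2l ?invr_ge0 ?normr_ge0 ?fq.
  rewrite expr2 -!mulrA mulKf ?normr_eq0 //.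
  apply: le_lt_trans (_ : `|h| * (M + 1) < e).
    by rewrite ler_wpM2l ?normr_ge0 ?lerDl ?ler01.
  by rewrite -ltr_pdivlMr.
split=> //; apply: DeriveDef; first by apply/cvg_ex; exists d.
by apply: cvg_lim => //; exact: norm_hausdorff.
Unshelve. all: by end_near. Qed.

Section EGF.
Variable R : realType.
Local Notation C := (cplx R).
Local Open Scope complex_scope.

Definition egf_term (s : nat -> C) (t : C) (k : nat) : C := s k * exp_term t k.
(** The exponential generating function of s, the sum of s_k t^k / k!. *)
Definition egf (s : nat -> C) (t : C) : C := limn (series (egf_term s t)).

Lemma toC_exp_term (x : R) k : toC (exp_coeff x k) = exp_term (toC x) k.
Proof.
by rewrite /exp_coeff /exp_term /= toCM toCX toCVnat.
Qed.

Variables (s : nat -> C) (r : R).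
Hypothesis r0 : 0 <= r.
Hypothesis sr : forall k, `|s k| <= toC (r ^+ k).

Lemma egf_cvg t : series (egf_term s t) @ \oo --> egf s t.
Proof.
apply: (@complex_normed_cvg _ _ (exp_coeff (complex.Re `|t| * r))); last first.
  exact: is_cvg_series_exp_coeff.
move=> k; rewrite toC_exp_term /egf_term toCM toC_norm.
rewrite /exp_term normrM normrM normrX normfV normr_nat exprMn !mulrA.
rewrite ler_wpM2r ?invr_ge0 ?ler0n // mulrC ler_wpM2l ?exprn_ge0 //.
by rewrite -toCX.
Qed.

(** The terms of index at least 2 are bounded by |t|^2 r^k / k! for |t| <= 1. *)
Lemma egf_quadratic t : `|t| <= 1 ->
  `|egf s t - (s 0%N + t * s 1%N)| <= `|t| ^+ 2 * toC (expR r).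
Proof.
move=> t1; apply/ler_addgt0Pr => e e0.
have /cvgrPdist_lt/(_ e e0)[n _ /(_ n.+2)] := @egf_cvg t.
rewrite /= -addn2 leq_addr => /(_ isT).
set S := series _ _ => nS.
rewrite -(subrK S (egf s t)) -addrA addrC.
apply: le_trans (ler_normD _ _) _; apply: lerD; last exact: ltW.
rewrite /S addn2 /series /= 2?big_nat_recl // /egf_term /exp_term.
rewrite expr0 expr1 !divr1 mulr1 [s 1%N * t]mulrC.
rewrite [X in X - _]addrA [X in X - _]addrC addrK.
apply: le_trans (ler_norm_sum _ _ _) _.
apply: (@le_trans _ _ (`|t| ^+ 2 * toC (\sum_(0 <= k < n) exp_coeff r k.+2))).
  rewrite toC_sum mulr_sumr; apply: ler_sum => k _.
  rewrite toC_exp_term /exp_term normrM normrM normrX normfV normr_nat.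
  rewrite mulrA [leRHS]mulrA ler_wpM2r ?invr_ge0 ?ler0n // [leLHS]mulrC.
  rewrite ler_pM ?exprn_ge0 ?normr_ge0 //; last first.
    by rewrite -toCX.
  by rewrite -addn2 exprD ler_piMl ?exprn_ge0 // exprn_ile1.
rewrite ler_wpM2l ?exprn_ge0 // toC_le.
apply: (@le_trans _ _ (series (exp_coeff r) n.+2)).
  rewrite [leRHS]big_nat_recl // [X in _ <= _ + X]big_nat_recl // addrA lerDr.
  by rewrite addr_ge0 ?exp_coeff_ge0.
apply: nondecreasing_cvgn_le; last exact: is_cvg_series_exp_coeff.
by apply: nondecreasing_series => k _ _; exact: exp_coeff_ge0.
Qed.

Lemma egf_is_derive : egf s 0 = s 0%N /\ is_derive (0 : C) 1 (egf s) (s 1%N).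
Proof.
apply: is_derive_quadratic egf_quadratic.
by rewrite (toC_le 0) expR_ge0.
Qed.

End EGF.

(** * The exponential of a traceless 2 x 2 matrix *)

(** The pair (a, b) such that c^n = a + b c for every c with c^2 = w: the
    coordinates of the powers of a formal square root of w. *)
Fixpoint sqrt_pow (K : comNzRingType) (w : K) (n : nat) : K * K :=
  if n is n'.+1 then (w * (sqrt_pow w n').2, (sqrt_pow w n').1) else (1, 0).

Lemma sqrt_powE (K : comNzRingType) (c : K) n :
  (sqrt_pow (c ^+ 2) n).1 + c * (sqrt_pow (c ^+ 2) n).2 = c ^+ n.
Proof.
elim: n => [|n IHn] /=; first by rewrite mulr0 addr0.
by rewrite [RHS]exprS -IHn; ring.
Qed.

Lemma sqrt_pow_norm (K : numFieldType) (w : K) n :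
  `|(sqrt_pow w n).1| <= (1 + `|w|) ^+ n /\
  `|(sqrt_pow w n).2| <= (1 + `|w|) ^+ n.
Proof.
have w1 : 1 <= 1 + `|w| by rewrite lerDl.
elim: n => [|n [IH1 IH2]] /=; first by rewrite normr1 normr0 ler01.
rewrite normrM exprS; split.
  by apply: ler_pM => //; rewrite lerDr ler01.
by rewrite -[X in X <= _]mul1r; apply: ler_pM.
Qed.

Section TwoByTwo.
Variable K : comNzRingType.

Lemma mx22_eta (u : 'M[K]_2) : u = mx22 (u 0 0) (u 0 1) (u 1 0) (u 1 1).
Proof.
apply/matrixP => i j; rewrite !mxE.
case: i => [[|[|//]] ip]; case: j => [[|[|//]] jp] /=;
  by congr (u _ _); exact: val_inj.
Qed.

Lemma mx22D (a b c d a' b' c' d' : K) :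
  mx22 a b c d + mx22 a' b' c' d' = mx22 (a + a') (b + b') (c + c') (d + d').
Proof.
by apply/matrixP => i j; rewrite !mxE; case: (i == 0); case: (j == 0).
Qed.

Lemma mx22_1 : mx22 1 0 0 1 = 1 :> 'M[K]_2.
Proof. by rewrite [RHS]mx22_eta !mxE. Qed.

Lemma trace0_eta (u : 'M[K]_2) : \tr u = 0 ->
  u = mx22 (u 0 0) (u 0 1) (u 1 0) (- u 0 0).
Proof.
move=> tu; rewrite {1}[u]mx22_eta; congr mx22.
by move: tu; rewrite {1}[u]mx22_eta mxtrace_mx22 addrC => /eqP;
  rewrite addr_eq0 => /eqP.
Qed.

Lemma trace0_det_comb (u : 'M[K]_2) (p q : K) : \tr u = 0 ->
  \det (p *: 1 + q *: u) = p ^+ 2 - q ^+ 2 * - \det u.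
Proof.
move=> /trace0_eta ->; rewrite -mx22_1 !mx22Z mx22D !det_mx22; ring.
Qed.

(** Cayley-Hamilton for a traceless matrix. *)
Lemma trace0_sqr (u : 'M[K]_2) : \tr u = 0 -> u * u = (- \det u) *: 1.
Proof.
move=> /trace0_eta ->; rewrite -mx22_1 mx22Z [LHS]mx22M det_mx22.
by congr mx22; ring.
Qed.

Lemma trace0_exp (u : 'M[K]_2) n : \tr u = 0 ->
  u ^+ n = (sqrt_pow (- \det u) n).1 *: 1 + (sqrt_pow (- \det u) n).2 *: u.
Proof.
move=> tu; elim: n => [|n IHn] /=; first by rewrite expr0 scale1r scale0r addr0.
rewrite exprS IHn mulrDr -!scalerAr mulr1 trace0_sqr // scalerA addrC.
by rewrite [_ * - _]mulrC.
Qed.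

End TwoByTwo.

Section ExpMatrix.
Variable R : realType.
Local Notation C := (cplx R).

(** The functions cosh (c t) and sinh (c t) / c of t, for c^2 = w. *)
Definition exp_even (w : C) : C -> C := egf (fun n => (sqrt_pow w n).1).
Definition exp_odd (w : C) : C -> C := egf (fun n => (sqrt_pow w n).2).

Let rad (w : C) : R := 1 + complex.Re `|w|.

Lemma rad_ge0 w : 0 <= rad w.
Proof. by rewrite addr_ge0 ?ler01 // -toC_le toC_norm; exact: normr_ge0. Qed.

Lemma toC_rad w n : toC (rad w ^+ n) = (1 + `|w|) ^+ n.
Proof. by rewrite toCX toCD toC_norm. Qed.

Lemma even_bound w n : `|(sqrt_pow w n).1| <= toC (rad w ^+ n).
Proof. by rewrite toC_rad; have [] := sqrt_pow_norm w n. Qed.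

Lemma odd_bound w n : `|(sqrt_pow w n).2| <= toC (rad w ^+ n).
Proof. by rewrite toC_rad; have [] := sqrt_pow_norm w n. Qed.

Lemma exp_even_cvg w t :
  series (egf_term (fun n => (sqrt_pow w n).1) t) @ \oo --> exp_even w t.
Proof. exact: (egf_cvg (even_bound w)). Qed.

Lemma exp_odd_cvg w t :
  series (egf_term (fun n => (sqrt_pow w n).2) t) @ \oo --> exp_odd w t.
Proof. exact: (egf_cvg (odd_bound w)). Qed.

Lemma exp_even_derive w :
  exp_even w 0 = 1 /\ is_derive (0 : C) 1 (exp_even w) 0.
Proof.
by have := egf_is_derive (rad_ge0 w) (even_bound w); rewrite /= mulr0.
Qed.

Lemma exp_odd_derive w : exp_odd w 0 = 0 /\ is_derive (0 : C) 1 (exp_odd w) 1.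
Proof. exact: (egf_is_derive (rad_ge0 w) (odd_bound w)). Qed.

(** By [trace0_exp] the partial sums are already combinations of 1 and u, so the
    matrix limit reduces to two scalar limits. *)
Lemma expmxE (u : 'M[C]_2) t : \tr u = 0 ->
  expmx (t *: u) = exp_even (- \det u) t *: 1 + exp_odd (- \det u) t *: u.
Proof.
move=> tu; apply: cvg_lim; first exact: norm_hausdorff.
have -> : series (fun n => n`!%:R^-1 *: (t *: u) ^+ n) =
   (fun n => series (egf_term (fun n => (sqrt_pow (- \det u) n).1) t) n *: 1
    + series (egf_term (fun n => (sqrt_pow (- \det u) n).2) t) n *: u).
  apply/funext => n; rewrite /series /= !scaler_suml -big_split /=.
  apply: eq_bigr => k _; rewrite exprZn trace0_exp //.
  rewrite scalerDr scalerDr !scalerA.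
  by rewrite /egf_term /exp_term; congr (_ *: _ + _ *: _); ring.
apply: cvgD; apply: cvgZr_tmp; [exact: exp_even_cvg | exact: exp_odd_cvg].
Qed.

(** With a square root c of w, P^2 - w Q^2 = (P + c Q) (P - c Q), and the
    factors are the limits of the partial sums of e^(c t) and e^(- c t).  The
    argument is run on partial sums, where [exp_partialN_cvg] gives the limit
    directly, and includes the nilpotent case c = 0. *)
Lemma even_odd_det w t : exp_even w t ^+ 2 - exp_odd w t ^+ 2 * w = 1.
Proof.
have [c cw] : exists c : C, w = c ^+ 2 by exists (sqrtC w); rewrite sqrtCK.
set a := series (egf_term (fun n => (sqrt_pow w n).1) t).
set b := series (egf_term (fun n => (sqrt_pow w n).2) t).
have ab (d : C) n : w = d ^+ 2 -> a n + d * b n = series (exp_term (d * t)) n.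
  move=> dw; rewrite /a /b /series /= mulr_sumr -big_split /=.
  apply: eq_bigr => k _.
  by rewrite /egf_term mulrA -mulrDl dw sqrt_powE /exp_term exprMn mulrA.
have h1 : (fun n => (a n) * (a n) - (b n) * (b n) * w) @ \oo --> (1 : C).
  rewrite (_ : (fun n => _) = (fun n => series (exp_term (c * t)) n *
      series (exp_term (- (c * t))) n)); first exact: exp_partialN_cvg.
  apply/funext => n; rewrite -ab // -[- (c * t)]mulNr -ab ?sqrrN // cw; ring.
have h2 : (fun n => (a n) * (a n) - (b n) * (b n) * w) @ \oo -->
    exp_even w t ^+ 2 - exp_odd w t ^+ 2 * w.
  rewrite !expr2; apply: cvgB.
    by apply: cvgM; exact: exp_even_cvg.
  by apply: cvgMr_tmp; apply: cvgM; exact: exp_odd_cvg.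
exact: (cvg_unique _ h2 h1).
Qed.

Lemma det_expmx (u : 'M[C]_2) t : \tr u = 0 -> \det (expmx (t *: u)) = 1.
Proof. by move=> tu; rewrite expmxE // trace0_det_comb // even_odd_det. Qed.

Lemma expmx0 (u : 'M[C]_2) : \tr u = 0 -> expmx (0 *: u) = 1.
Proof.
move=> tu; rewrite expmxE // (exp_even_derive _).1 (exp_odd_derive _).1.
by rewrite scale1r scale0r addr0.
Qed.

Lemma expmx_is_derive (u : 'M[C]_2) i j : \tr u = 0 ->
  is_derive (0 : C) 1 (fun t : C => expmx (t *: u) i j) (u i j).
Proof.
move=> tu; have [_ ed] := exp_even_derive (- \det u).
have [_ qd] := exp_odd_derive (- \det u).
rewrite (_ : (fun t : C => _) =
   (i == j)%:R \*: exp_even (- \det u) + u i j \*: exp_odd (- \det u)).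
  have h := is_deriveD (is_deriveZ (i == j)%:R ed) (is_deriveZ (u i j) qd).
  by apply: is_derive_eq h _; rewrite scaler0 add0r [LHS]mulr1.
by apply/funext => t; rewrite expmxE // !mxE mulrC [X in _ + X]mulrC.
Qed.

End ExpMatrix.

(** * Coordinates and curves on the big cell *)

Section BigCellCoordinates.
Variable K : numClosedFieldType.
Local Notation F := (fock K).
Implicit Types (g : bigcell K) (x y z : K).

Lemma bruhat00 x y z (hz : z != 0) : bruhat x y hz 0 0 = x * z.
Proof. by rewrite /= bruhat_mxE // mxE. Qed.
Lemma bruhat10 x y z (hz : z != 0) : bruhat x y hz 1 0 = z.
Proof. by rewrite /= bruhat_mxE // mxE. Qed.
Lemma bruhat11 x y z (hz : z != 0) : bruhat x y hz 1 1 = z * y.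
Proof. by rewrite /= bruhat_mxE // mxE. Qed.
Lemma bruhat01 x y z (hz : z != 0) : bruhat x y hz 0 1 = x * z * y - z^-1.
Proof. by rewrite /= bruhat_mxE // mxE. Qed.

Lemma bigcell_bruhat g : exists x y z (hz : z != 0), g = bruhat x y hz.
Proof.
case: g => m mP; have /asboolP[x [y [z [hz e]]]] := mP.
by exists x, y, z, hz; apply: val_inj.
Qed.

Lemma bigcell10_neq0 g : g 1 0 != 0.
Proof. by have [x [y [z [hz ->]]]] := bigcell_bruhat g; rewrite bruhat10. Qed.

(** The entries m00, m10, m11 determine x, zeta, y, and then det = 1
    forces m01. *)
Lemma det1_in_bigcell (m : 'M[K]_2) :
  \det m = 1 -> m 1 0 != 0 -> m \in @bigcell_pred K.
Proof.
move=> d1 m0; apply/asboolP; exists (m 0 0 / m 1 0), (m 1 1 / m 1 0), (m 1 0).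
split=> //; rewrite bruhat_mxE // {1}[m]mx22_eta.
move: d1; rewrite [m in \det m]mx22_eta det_mx22 => d1.
have -> : m 0 1 = (m 0 0 * m 1 1 - 1) / m 1 0 by rewrite -d1; field.
by congr mx22; field.
Qed.

(** In Bruhat form the matrix has entries g00 = x zeta, g10 = zeta and
    g11 = zeta y, so the coordinates are the quotients used here. *)
Fact coord_x_subproof : (fun g => g 0 0 / g 1 0) \in @regular_fun K.
Proof.
apply/regular_funP; exists [:: (1, 1%N, 0%N, 0)] => x y z hz.
by rewrite big_seq1 bruhat00 bruhat10 /= mulfK // mul1r !mulr1.
Qed.
Definition coord_x : regular K := Regular coord_x_subproof.

Fact coord_y_subproof : (fun g => g 1 1 / g 1 0) \in @regular_fun K.
Proof.
apply/regular_funP; exists [:: (1, 0%N, 1%N, 0)] => x y z hz.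
by rewrite big_seq1 bruhat11 bruhat10 /= mulrC mulKf // !mul1r mulr1.
Qed.
Definition coord_y : regular K := Regular coord_y_subproof.

Fact coord_z_subproof (l : int) : (fun g => g 1 0 ^ l) \in @regular_fun K.
Proof.
apply/regular_funP; exists [:: (1, 0%N, 0%N, l)] => x y z hz.
by rewrite big_seq1 bruhat10 /= !mul1r.
Qed.
Definition coord_z l : regular K := Regular (coord_z_subproof l).

Lemma regularD (f h : regular K) g : (f + h) g = f g + h g. Proof. by []. Qed.
Lemma regularM (f h : regular K) g : (f * h) g = f g * h g. Proof. by []. Qed.
Lemma regularN (f : regular K) g : (- f) g = - f g. Proof. by []. Qed.
Lemma regularZ c (f : regular K) g : (c *: f) g = c * f g. Proof. by []. Qed.
Lemma regular0 g : (0 : regular K) g = 0. Proof. by []. Qed.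
Lemma regular1 g : (1 : regular K) g = 1. Proof. by []. Qed.
Lemma regularX (f : regular K) n g : (f ^+ n) g = f g ^+ n.
Proof. by elim: n => [//|n IHn]; rewrite !exprS regularM IHn. Qed.

Lemma coord_z0 : coord_z 0 = 1.
Proof. exact: val_inj. Qed.

Lemma coord_zD k l : coord_z (k + l) = coord_z k * coord_z l.
Proof.
by apply: val_inj; apply/funext => g; rewrite /= expfzDr // bigcell10_neq0.
Qed.

Definition coordinates (Phi : {lrmorphism F -> regular K}) : Prop :=
  [/\ Phi beta = coord_x, Phi betab = - coord_y &
      forall l, Phi (one_ l) = coord_z l].

Lemma exists_coordinates : exists Phi, coordinates Phi.
Proof. exact: (fock_universal _ _ coord_z0 coord_zD). Qed.

Section Phi.
Variable Phi : {lrmorphism F -> regular K}.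
Hypothesis PhiP : coordinates Phi.

Lemma Phi0 : Phi 0 = 0. Proof. exact: raddf0. Qed.
Lemma Phi1 : Phi 1 = 1. Proof. exact: rmorph1. Qed.
Lemma PhiN p : Phi (- p) = - Phi p. Proof. exact: raddfN. Qed.
Lemma PhiD p q : Phi (p + q) = Phi p + Phi q. Proof. exact: raddfD. Qed.
Lemma PhiM p q : Phi (p * q) = Phi p * Phi q. Proof. exact: rmorphM. Qed.
Lemma PhiZ c p : Phi (c *: p) = c *: Phi p. Proof. exact: linearZZ. Qed.

Lemma Phi_beta x y z (hz : z != 0) : Phi beta (bruhat x y hz) = x.
Proof.
by case: PhiP => -> _ _; rewrite -[LHS]/(_ / _) bruhat00 bruhat10 mulfK.
Qed.

Lemma Phi_betab x y z (hz : z != 0) : Phi betab (bruhat x y hz) = - y.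
Proof.
case: PhiP => _ -> _; rewrite regularN -[X in - X]/(_ / _) bruhat11 bruhat10.
by rewrite mulrC mulKf.
Qed.

Lemma Phi_one l x y z (hz : z != 0) : Phi (one_ l) (bruhat x y hz) = z ^ l.
Proof. by case: PhiP => _ _ ->; rewrite -[LHS]/(_ ^ _) bruhat10. Qed.

Lemma Phi_monomial m n l x y z (hz : z != 0) :
  Phi (beta ^+ m * betab ^+ n * one_ l) (bruhat x y hz)
  = x ^+ m * (- y) ^+ n * z ^ l.
Proof.
by rewrite !PhiM !rmorphXn !regularM !regularX Phi_beta Phi_betab Phi_one.
Qed.

(** Identifies Phi with evaluation of Laurent polynomials, which makes
    [fock_eval_inj] available for injectivity. *)
Lemma Phi_eval p x y z (hz : z != 0) :
  Phi p (bruhat x y hz) = fock_eval x y z p.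
Proof.
elim/fock_ind: p => [|p q IHp IHq|c m n l].
- by rewrite raddf0 fock_eval0.
- by rewrite PhiD regularD IHp IHq fock_evalD.
- by rewrite PhiZ regularZ Phi_monomial fock_eval_monomial.
Qed.

Lemma Phi_inj : injective Phi.
Proof.
move=> p q /eqP; rewrite -subr_eq0 -raddfB => /eqP pq0.
apply/eqP; rewrite -subr_eq0; apply/eqP/fock_eval_inj => x y z hz.
by rewrite -Phi_eval pq0.
Qed.

Lemma Phi_surj psi : exists p, Phi p = psi.
Proof.
have /regular_funP[s psiE] := valP psi.
(* betab is - y, so y^n lifts to (-1)^n betab^n. *)
exists (\sum_(t <- s)
  (t.1.1.1 * (-1) ^+ t.1.2) *: (beta ^+ t.1.1.2 * betab ^+ t.1.2 * one_ t.2)).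
apply: val_inj; apply/funext => g; have [x [y [z [hz ->]]]] := bigcell_bruhat g.
rewrite [RHS]psiE {psiE}.
elim: s => [|t s IHs]; first by rewrite !big_nil raddf0.
rewrite !big_cons -IHs PhiD [LHS]regularD; congr (_ + _).
rewrite PhiZ [LHS]regularZ Phi_monomial (exprNn y).
have := sqrr_sign K t.1.2; rewrite expr2; set e := (-1) ^+ _ => ee.
rewrite -[RHS]mul1r -[X in _ = X * _]ee; ring.
Qed.

Lemma Phi_bij : bijective Phi.
Proof.
have [f fP] := choice Phi_surj.
by exists f => // p; apply: Phi_inj; rewrite fP.
Qed.

(** The monomials span the Fock space and a regular function is determined by
    its values in Bruhat form. *)
Lemma Phi_unique (Psi : {linear F -> regular K}) :
  (forall m n l x y z (hz : z != 0),
    Psi (beta ^+ m * betab ^+ n * one_ l) (bruhat x y hz)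
    = x ^+ m * (- y) ^+ n * z ^ l) <-> Psi =1 Phi.
Proof.
split=> [PsiE|e m n l x y z hz]; last by rewrite e Phi_monomial.
apply: fock_ind => [|p q ep eq|c m n l].
- by rewrite !raddf0.
- by rewrite PhiD -ep -eq raddfD.
rewrite [LHS]linearZ [RHS]PhiZ; congr (_ *: _).
apply: val_inj; apply/funext => g; have [x [y [z [hz ->]]]] := bigcell_bruhat g.
by rewrite [LHS]PsiE [RHS]Phi_monomial.
Qed.

Lemma ext0_bigcell (psi : bigcell K -> K) g : ext0 psi g = psi g.
Proof. by rewrite /ext0 valK. Qed.

Lemma ext0D (f h : regular K) m : ext0 (f + h) m = ext0 f m + ext0 h m.
Proof. by rewrite /ext0; case: insub => //=; rewrite addr0. Qed.

Lemma ext0M (f h : regular K) m : ext0 (f * h) m = ext0 f m * ext0 h m.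
Proof. by rewrite /ext0; case: insub => //=; rewrite mulr0. Qed.

(** A curve of determinant one through g at time 0, with velocity v there; the
    two cases of interest are e^(-tu) g and g e^(tu). *)
Section Curve.
Variables (g : bigcell K) (M : K -> 'M[K]_2) (v : 'M[K]_2).
Hypothesis M0 : M 0 = g.
Hypothesis Mdet : forall t, \det (M t) = 1.
Hypothesis Mder : forall i j, is_derive (0 : K) 1 (fun t => M t i j) (v i j).

Lemma curve_near : \forall t \near (0 : K), M t 1 0 != 0.
Proof.
have /derivable1_diffP/differentiable_continuous c :=
  @ex_derive _ _ _ _ _ _ _ (Mder 1 0).
have : (fun t => M t 1 0) t @[t --> (0 : K)] --> M 0 1 0 by exact: c.
move/cvgrPdist_lt => /(_ `|M 0 1 0|); rewrite normr_gt0 M0 bigcell10_neq0.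
move=> /(_ isT); apply: filterS => t h; apply/eqP => t0.
by move: h; rewrite t0 subr0 ltxx.
Qed.

(** Near 0 the curve stays in the big cell, so the value outside it chosen in
    [ext0] does not affect the derivative. *)
Lemma curve_ext0 (psi : bigcell K -> K) (f : 'M[K]_2 -> K) df :
  (forall h, psi h = f h) -> is_derive (0 : K) 1 (fun t => f (M t)) df ->
  is_derive (0 : K) 1 (fun t => ext0 psi (M t)) df.
Proof.
move=> psif; apply: near_eq_is_derive; move: curve_near; apply: filterS => t t0.
have mP := det1_in_bigcell (Mdet t) t0.
by rewrite -[M t]/(bigcell_val (BigCell mP)) ext0_bigcell psif.
Qed.

Lemma curve_inv : is_derive (0 : K) 1 (fun t => (M t 1 0)^-1)
  (- (g 1 0) ^- 2 * v 1 0).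
Proof.
have d := Mder 1 0; have n0 : M 0 1 0 != 0 by rewrite M0 bigcell10_neq0.
apply: DeriveDef; first exact: derivableV.
by rewrite deriveV // derive_val M0.
Qed.

Lemma curve_quot i j : is_derive (0 : K) 1 (fun t => M t i j / M t 1 0)
  (v i j / g 1 0 - g i j * v 1 0 / g 1 0 ^+ 2).
Proof.
have h := is_deriveM (Mder i j) curve_inv.
rewrite M0 in h; apply: is_derive_eq h _.
rewrite /GRing.scale /=; have := bigcell10_neq0 g; set z := g 1 0 => z0; field.
exact: z0.
Qed.

(** The set of p for which the derivative along the curve is the value of D p is
    a subalgebra by the Leibniz rule on both sides.  The hypotheses say that it
    contains beta, betab and 1_1; it contains 1_(-1) by the quotient rule on one
    side and [derivation_oneV] on the other. *)
Lemma derivation_along_curve (D : F -> F) :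
  derivation D -> (forall c, D (c%:A) = 0) ->
  Phi (D beta) g = v 0 0 / g 1 0 - g 0 0 * v 1 0 / g 1 0 ^+ 2 ->
  Phi (D betab) g = - (v 1 1 / g 1 0 - g 1 1 * v 1 0 / g 1 0 ^+ 2) ->
  Phi (D (one_ 1)) g = v 1 0 ->
  forall p, is_derive (0 : K) 1 (fun t => ext0 (Phi p) (M t)) (Phi (D p) g).
Proof.
move=> dD DC Db Dbb D1; case: PhiP => Pb Pbb P1.
have val0 p : ext0 (Phi p) (M 0) = Phi p g by rewrite M0 ext0_bigcell.
apply: fock_alg_ind.
- move=> p q dp dq; have h := is_deriveD dp dq.
  rewrite dD.1 (PhiD (D p)) regularD.
  rewrite (_ : (fun t => _) =
     (fun t => ext0 (Phi p) (M t)) + (fun t => ext0 (Phi q) (M t))) //.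
  by apply/funext => t; rewrite PhiD [LHS]ext0D.
- move=> p q dp dq; have h := is_deriveM dp dq.
  rewrite dD.2 (PhiD (D p * q)) !(PhiM (D p), PhiM p (D q)) regularD !regularM.
  rewrite (_ : (fun t => _) =
     (fun t => ext0 (Phi p) (M t)) * (fun t => ext0 (Phi q) (M t))).
    by apply: is_derive_eq h _; rewrite !val0 /GRing.scale /= addrC mulrC.
  by apply/funext => t; rewrite PhiM [LHS]ext0M.
- move=> c; rewrite DC Phi0 regular0.
  apply: (@curve_ext0 (Phi c%:A) (fun=> c)) => [h|]; last exact: is_derive_cst.
  by rewrite PhiZ Phi1 regularZ regular1 mulr1.
- rewrite Db Pb; apply: (@curve_ext0 coord_x (fun m => m 0 0 / m 1 0)) => //.
  exact: curve_quot.
- rewrite Dbb Pbb.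
  apply: (@curve_ext0 (- coord_y) (fun m => - (m 1 1 / m 1 0))) => //.
  exact: is_deriveN (curve_quot 1 1).
- by rewrite D1 P1; apply: (@curve_ext0 (coord_z 1) (fun m => m 1 0)).
- have -> : Phi (D (one_ (- 1))) g = - (g 1 0) ^- 2 * v 1 0.
    rewrite (derivation_oneV dD) expr2 PhiM PhiN PhiM regularM regularN.
    by rewrite regularM D1 P1 -[coord_z _ g]/((g 1 0)^-1) expr2 invfM.
  rewrite P1; apply: (@curve_ext0 (coord_z (- 1)) (fun m => (m 1 0)^-1)) => //.
  exact: curve_inv.
Qed.

End Curve.
End Phi.
End BigCellCoordinates.

(** * Comparison with the regular actions *)

Section Intertwining.
Variable R : realType.
Local Notation K := (cplx R).
Variable Phi : {lrmorphism fock K -> regular K}.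
Hypothesis PhiP : coordinates Phi.

Lemma sl2_tr (u : sl2 K) : \tr (sl2_val u) = 0.
Proof. by case: u => m /= /eqP. Qed.

Section Evaluation.
Variable g : bigcell K.
Let ev p : K := Phi p g.

Lemma evD p q : ev (p + q) = ev p + ev q. Proof. by rewrite /ev PhiD. Qed.
Lemma evN p : ev (- p) = - ev p. Proof. by rewrite /ev PhiN. Qed.
Lemma evM p q : ev (p * q) = ev p * ev q. Proof. by rewrite /ev PhiM. Qed.
Lemma evZ c : ev (c%:A) = c.
Proof. by rewrite /ev PhiZ Phi1 regularZ regular1 mulr1. Qed.
End Evaluation.

(** In the coordinates, with betab = - y and 1_(-2) = zeta^(-2), the vector
    fields of the Fock space become explicit functions on the big cell. *)
Lemma Phi_vf_gam w x y z (hz : z != 0) :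
  Phi (vf_gam beta (one_ (- 2)) w) (bruhat x y hz) =
  w.1 0 1 + 2 * w.1 0 0 * x - w.1 1 0 * x ^+ 2 + w.2 1 0 / z ^+ 2.
Proof.
have := ev_vf_gam beta (one_ (- 2))
  (evD _) (evN _) (evM _) (evZ (bruhat x y hz)) w.
by rewrite (Phi_beta PhiP) (Phi_one PhiP).
Qed.

Lemma Phi_vf_gamb w x y z (hz : z != 0) :
  Phi (vf_gamb betab (one_ (- 2)) w) (bruhat x y hz) =
  w.2 0 1 - 2 * w.2 0 0 * y - w.2 1 0 * y ^+ 2 + w.1 1 0 / z ^+ 2.
Proof.
have := ev_vf_gamb betab (one_ (- 2))
  (evD _) (evN _) (evM _) (evZ (bruhat x y hz)) w.
by rewrite (Phi_betab PhiP) (Phi_one PhiP) mulrN sqrrN.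
Qed.

Lemma Phi_vf_a w x y z (hz : z != 0) :
  Phi (vf_a beta betab w) (bruhat x y hz) =
  w.1 0 0 - w.1 1 0 * x + w.2 0 0 + w.2 1 0 * y.
Proof.
have := ev_vf_a beta betab (evD _) (evN _) (evM _) (evZ (bruhat x y hz)) w.
by rewrite (Phi_beta PhiP) (Phi_betab PhiP) mulrN opprK.
Qed.

(** The curve is exp (t (- u)) g, with velocity - u g; only the generators need
    to be compared. *)
Lemma orbit_l_derive (u : sl2 K) p (g : bigcell K) :
  is_derive (0 : K) 1 (orbit_l u (Phi p) g) (Phi (rho (u, 0) p) g).
Proof.
have tu : \tr (- sl2_val u) = 0 by rewrite raddfN /= sl2_tr oppr0.
pose M t : 'M[K]_2 := expmx (t *: (- sl2_val u)) *m g.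
rewrite (_ : orbit_l u (Phi p) g = fun t => ext0 (Phi p) (M t)); last first.
  by apply/funext => t; rewrite /orbit_l /M scalerN scaleNr.
have [x [y [z [hz gE]]]] := bigcell_bruhat g.
have g00 : g 0 0 = x * z by rewrite gE bruhat00.
have g01 : g 0 1 = x * z * y - z^-1 by rewrite gE bruhat01.
have g10 : g 1 0 = z by rewrite gE bruhat10.
have g11 : g 1 1 = z * y by rewrite gE bruhat11.
have u11 := sl2_11 u.
apply: (derivation_along_curve PhiP (M := M) (v := (- sl2_val u) *m g)).
- by rewrite /M expmx0 // mul1mx.
- move=> t; rewrite /M det_mulmx det_expmx // gE /= det_bruhat_mx //.
  by rewrite mulr1.
- move=> i j; rewrite (_ : (fun t => _) = (fun t : K =>
    g 0 j *: expmx (t *: - sl2_val u) i 0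
    + g 1 j *: expmx (t *: - sl2_val u) i 1)).
    have h k := expmx_is_derive i k tu.
    have hh := is_deriveD (is_deriveZ (g 0 j) (h 0)) (is_deriveZ (g 1 j) (h 1)).
    apply: is_derive_eq hh _.
    by rewrite mulmx2; congr (_ + _); exact: mulrC.
  apply/funext => t; rewrite /M mulmx2.
  by congr (_ + _); exact: mulrC.
- exact: derivation_rho.
- exact: rho_scalar.
- rewrite rho_beta (PhiN Phi) regularN gE Phi_vf_gam -gE g00 g10 !mulmx2 !mxE.
  rewrite g00 g10 u11; field; exact: hz.
- rewrite rho_betab (PhiN Phi) regularN gE Phi_vf_gamb -gE g11 g10 !mulmx2 !mxE.
  rewrite g00 g10 g01 g11 u11; field; exact: hz.
- rewrite rho_one (PhiM Phi) regularM gE Phi_vf_a (Phi_one PhiP) -gE.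
  rewrite !mulmx2 !mxE.
  rewrite g00 g10 u11; ring.
Qed.

(** The same comparison for the curve g exp (t u), with velocity g u. *)
Lemma orbit_r_derive (u : sl2 K) p (g : bigcell K) :
  is_derive (0 : K) 1 (orbit_r u (Phi p) g) (Phi (rho (0, u) p) g).
Proof.
have tu := sl2_tr u.
pose M t : 'M[K]_2 := g *m expmx (t *: sl2_val u).
rewrite (_ : orbit_r u (Phi p) g = fun t => ext0 (Phi p) (M t)) //.
have [x [y [z [hz gE]]]] := bigcell_bruhat g.
have g00 : g 0 0 = x * z by rewrite gE bruhat00.
have g01 : g 0 1 = x * z * y - z^-1 by rewrite gE bruhat01.
have g10 : g 1 0 = z by rewrite gE bruhat10.
have g11 : g 1 1 = z * y by rewrite gE bruhat11.
have u11 := sl2_11 u.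
apply: (derivation_along_curve PhiP (M := M) (v := g *m sl2_val u)).
- by rewrite /M expmx0 // mulmx1.
- move=> t; rewrite /M det_mulmx det_expmx // gE /= det_bruhat_mx //.
  by rewrite mulr1.
- move=> i j; rewrite (_ : (fun t => _) = (fun t : K =>
    g i 0 *: expmx (t *: sl2_val u) 0 j + g i 1 *: expmx (t *: sl2_val u) 1 j)).
    have h k := expmx_is_derive k j tu.
    have hh := is_deriveD (is_deriveZ (g i 0) (h 0)) (is_deriveZ (g i 1) (h 1)).
    by apply: is_derive_eq hh _; rewrite mulmx2.
  by apply/funext => t; rewrite /M mulmx2.
- exact: derivation_rho.
- exact: rho_scalar.
- rewrite rho_beta (PhiN Phi) regularN gE Phi_vf_gam -gE g00 g10 !mulmx2 !mxE.
  rewrite g00 g10 g01 g11; field; exact: hz.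
- rewrite rho_betab (PhiN Phi) regularN gE Phi_vf_gamb -gE g11 g10 !mulmx2 !mxE.
  rewrite g10 g11 u11; field; exact: hz.
- rewrite rho_one (PhiM Phi) regularM gE Phi_vf_a (Phi_one PhiP) -gE.
  rewrite !mulmx2 !mxE.
  rewrite g10 g11; ring.
Qed.

End Intertwining.

Theorem theorem1p2 (R : realType) :
  exists (rho : sl2 (cplx R) * sl2 (cplx R) -> fock (cplx R) -> fock (cplx R))
         (Phi : {lrmorphism fock (cplx R) -> regular (cplx R)}),
    [/\ lie_module (@sl2x2_bracket (cplx R)) rho,
        forall p,
          [/\ rho (sl2_e, 0) p = gam p,
              rho (sl2_h, 0) p = 2 * beta * gam p + aop p
            & rho (sl2_f, 0) p
              = - beta ^+ 2 * gam p - beta * aop p + gamb (one_ (- 2) * p)],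
        forall p,
          [/\ rho (0, sl2_e) p = gamb p,
              rho (0, sl2_h) p = 2 * betab * gamb p + aop p
            & rho (0, sl2_f) p
              = - betab ^+ 2 * gamb p - betab * aop p + gam (one_ (- 2) * p)]
      & lie_compatible rho] /\
    [/\ forall Psi : {linear fock (cplx R) -> regular (cplx R)},
          (forall m n l (x y z : cplx R) (hz : z != 0),
             Psi (beta ^+ m * betab ^+ n * one_ l) (bruhat x y hz)
             = x ^+ m * (- y) ^+ n * z ^ l) <-> Psi =1 Phi,
        bijective Phi,
        forall u (psi : regular (cplx R)) (g : bigcell (cplx R)),
          derivable (orbit_l u psi g) 0 1 /\ derivable (orbit_r u psi g) 0 1
      & forall u p, Phi (rho (u, 0) p) =1 pi_l u (Phi p) /\
                    Phi (rho (0, u) p) =1 pi_r u (Phi p)].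
Proof.
have [Phi PhiP] := exists_coordinates (cplx R).
exists (@rho (cplx R)), Phi; split; split.
- exact: rho_lie_module.
- move=> p; split; [exact: vf_left_e | exact: vf_left_h |].
  by rewrite gamb_one; exact: vf_left_f.
- move=> p; split; [exact: vf_right_e | exact: vf_right_h |].
  by rewrite gam_one; exact: vf_right_f.
- by move=> w p q; exact: (derivation_rho w).2.
- exact: (Phi_unique PhiP).
- exact: (Phi_bij PhiP).
- move=> u psi g; have [p <-] := Phi_surj PhiP psi.
  split; [have [d _] := orbit_l_derive PhiP u p g
         | have [d _] := orbit_r_derive PhiP u p g]; exact: d.
- move=> u p; split=> g.
    have [_ dE] := orbit_l_derive PhiP u p g; exact: (esym dE).
  have [_ dE] := orbit_r_derive PhiP u p g; exact: (esym dE).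
Qed.
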